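(* Let $E,F$ be locally convex spaces and let $\Phi\in\mathcal{C}(E,F)$, i.e. $\Phi:E\to F$ is continuous. Then the following conditions are equivalent: (i) $\Phi$ is a polynomial; (ii) there is $m\in\mathbb{N}$ such that $\nu\circ\Phi\circ\mathbf{h}\in P_m(\mathbb{R})$ for every $\nu\in F^*$ and every $\mathbf{h}\in\mathrm{Aff}(\mathbb{R},E)$; (iii) $\operatorname{span}\{\nu\circ\Phi\circ\mathbf{g} : \nu\in F^*,\ \mathbf{g}\in\mathrm{Aff}(E,E)\}$ is not dense in $\mathcal{C}(E)$. If additionally $E$ and $F^*$ (with some topology stronger than weak* ) are Baire, then the conditions above are equivalent to the fact that $\nu\circ\Phi\circ\mathbf{h}$ is a polynomial for every $\nu\in F^*$ and every $\mathbf{h}\in\mathrm{Aff}(\mathbb{R},E)$.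
   Context: All vector spaces are real and non-trivial (not $\{0\}$), and locally convex spaces are Hausdorff. For a topological vector space $F$, $F^*$ is its topological dual. For topological vector spaces $E,F$, $\mathrm{Aff}(E,F)$ is the set of maps $e\mapsto Te+f$ with $T:E\to F$ a continuous linear operator and $f\in F$ fixed. $P_m(\mathbb{R})$ is the space of real polynomial functions on $\mathbb{R}$ of degree at most $m$. $\mathcal{C}(E)$ is the space of continuous real-valued functions on $E$ with the compact-open topology (uniform convergence on compact sets). A map $\Phi:E\to F$ between vector spaces is a polynomial (of degree $n\in\mathbb{N}$) if there are a constant $M_0\in F$ and maps $M_k:E^k\to F$, $k=1,\dots,n$, each linear separately in each coordinate and symmetric (invariant under every permutation of its arguments), such that $\Phi(e)=M_0+M_1(e)+M_2(e,e)+\dots+M_n(e,\dots,e)$ for all $e\in E$.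
   Formalization: The topology on F^* stronger than weak* is required to be a vector space topology (continuous addition and scaling); for arbitrary topologies the last claim fails, e.g. discrete F^* with E = R, F = R^N, Φ(x) = (x, x^2, x^3, ...). *)

(* Defs.v *)
From HB Require Import structures.
From mathcomp Require Import all_boot all_order all_algebra all_fingroup.
From mathcomp Require Import all_classical all_reals all_analysis.

Set Implicit Arguments.
Unset Strict Implicit.
Unset Printing Implicit Defensive.

Import Order.TTheory GRing.Theory Num.Theory.
Import numFieldNormedType.Exports.

Local Open Scope classical_set_scope.
Local Open Scope ring_scope.

(* The real line, seen as a locally convex space, is R^o. A locally convex
   space is a tvsType R; the library does not include the Hausdorff axiom in
   this structure. *)

Definition multilinear (R : realType) (k : nat) (V W : lmodType R)
    (M : ('I_k -> V) -> W) : Prop :=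
  forall (i : 'I_k) (x : 'I_k -> V),
    linear (fun v : V => M (fun j => if j == i then v else x j)).

Definition symmetric_map (k : nat) (V W : Type) (M : ('I_k -> V) -> W) : Prop :=
  forall (s : 'S_k) (x : 'I_k -> V), M (x \o s) = M x.

(* M 0 is not used. *)
Definition is_polynomial (R : realType) (V W : lmodType R) (f : V -> W) : Prop :=
  exists (n : nat) (M0 : W) (M : forall k : nat, ('I_k -> V) -> W),
    (forall k, (1 <= k <= n)%N -> multilinear (M k) /\ symmetric_map (M k)) /\
    (forall v, f v = M0 + \sum_(1 <= k < n.+1) M k (fun=> v)).

Definition polynomial_functions (R : realType) (m : nat) : set (R^o -> R^o) :=
  [set f | exists2 p : {poly R}, (size p <= m.+1)%N & forall t, f t = p.[t]].

Definition Aff (R : realType) (E F : tvsType R) : set (E -> F) :=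
  [set g | exists T : {linear E -> F},
     continuous T /\ exists f : F, forall e, g e = T e + f].

Section TopologicalDual.
Context (R : realType) (F : tvsType R).

Definition continuous_functional : {pred F -> R^o} :=
  mem [set nu : F -> R^o | linear nu /\ continuous nu].

Lemma continuous_functional_submod_closed :
  submod_closed continuous_functional.
Proof.
split.
  by rewrite inE; split=> [a u v|]; [rewrite /= scaler0 addr0|exact: cst_continuous].
move=> a f g /[!inE]/= -[lf cf] [lg cg]; split=> [b u v|x].
  rewrite -[LHS]/(a *: f (b *: u + v) + g (b *: u + v)) lf lg.
  rewrite -[RHS]/(b *: (a *: f u + g u) + (a *: f v + g v)).
  by rewrite !scalerDr !scalerA (mulrC a b) addrACA.
apply: (@cvgD _ _ _ _ _ (a *: f) g); last exact: cg.
by apply: cvgZr; exact: cf.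
Qed.

HB.instance Definition _ := GRing.isSubmodClosed.Build R (F -> R^o)
  continuous_functional continuous_functional_submod_closed.

Record dual := Dual {
  dual_fun :> F -> R^o;
  _ : dual_fun \in continuous_functional }.

HB.instance Definition _ := [isSub for dual_fun].
HB.instance Definition _ := gen_eqMixin dual.
HB.instance Definition _ := gen_choiceMixin dual.
HB.instance Definition _ := [SubChoice_isSubLmodule of dual by <:].

End TopologicalDual.

Definition weak_star (R : realType) (F : tvsType R) : Type :=
  initial_topology ((fun nu => nu) : dual F -> {ptws F -> R^o}).
HB.instance Definition _ (R : realType) (F : tvsType R) :=
  Topological.copy (weak_star F)
    (initial_topology ((fun nu => nu) : dual F -> {ptws F -> R^o})).

Record topology_on (T : Type) := TopologyOn {
  open_in : set_system T;
  open_in_setT : open_in setT;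
  open_in_setI : setI_closed open_in;
  open_in_bigcup : forall (I : Type) (f : I -> set T),
    (forall i, open_in (f i)) -> open_in (\bigcup_i f i) }.

Definition with_topology (R : realType) (V : lmodType R)
  (tau : topology_on V) : Type := V.
HB.instance Definition _ (R : realType) (V : lmodType R)
    (tau : topology_on V) := GRing.Lmodule.on (with_topology tau).
HB.instance Definition _ (R : realType) (V : lmodType R)
    (tau : topology_on V) :=
  isOpenTopological.Build (with_topology tau)
    (open_in_setT tau) (open_in_setI (t := tau)) (open_in_bigcup (t := tau)).

Definition vector_topology (R : realType) (V : lmodType R)
    (tau : topology_on V) : Prop :=
  continuous (fun z : with_topology tau * with_topology tau => z.1 + z.2) /\
  continuous (fun z : R^o * with_topology tau => z.1 *: z.2).

Definition stronger_than_weak_star (R : realType) (F : tvsType R)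
    (tau : topology_on (dual F)) : Prop :=
  forall A : set (weak_star F), open A -> open_in tau A.

Definition baire_space (T : topologicalType) : Prop :=
  forall U : (set T)^nat,
    (forall i, open (U i) /\ dense (U i)) -> dense (\bigcap_i U i).

Definition cont_fun (R : realType) (E : tvsType R) : Type :=
  initial_topology
    ((fun f => f) : continuousType E R^o -> {compact-open, E -> R^o}).
HB.instance Definition _ (R : realType) (E : tvsType R) :=
  Topological.copy (cont_fun E)
    (initial_topology
      ((fun f => f) : continuousType E R^o -> {compact-open, E -> R^o})).

Definition linear_span (R : realType) (V : lmodType R) (A : set V) : set V :=
  [set v | exists (n : nat) (c : 'I_n -> R) (a : 'I_n -> V),
     (forall i, A (a i)) /\ v = \sum_(i < n) c i *: a i].

(* The span of a set of continuous functions consists of continuous functions,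
   so it may be computed in the space of all functions E -> R. *)
Definition span_in_cont_fun (R : realType) (E : tvsType R)
    (A : set (E -> R^o)) : set (cont_fun E) :=
  [set f | linear_span A (f : continuousType E R^o)].

(* Main.v *)
Require Import Defs.
From HB Require Import structures.
From mathcomp Require Import all_boot all_order all_algebra all_fingroup.
From mathcomp Require Import all_classical all_reals all_analysis.
From mathcomp Require Import zify ring lra.

Set Implicit Arguments.
Unset Strict Implicit.
Unset Printing Implicit Defensive.

Import Order.TTheory GRing.Theory Num.Theory.
Import numFieldNormedType.Exports.

Local Open Scope classical_set_scope.
Local Open Scope ring_scope.

(* (ii) says that differences of some order m + 1 of nu o Phi vanish along all
   lines. By Hahn-Banach they vanish for Phi itself, and Djokovic's polarization
   identity extends this to mixed differences; the mixed difference of order m at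
   0, divided by m!, is then a symmetric multilinear form, and subtracting its
   diagonal lowers the degree.
   If (ii) holds, a difference of order m + 1 is a continuous functional on C(E)
   which kills the span but not lambda^(m+1), for lambda in E^*. If (ii) fails,
   then for each n some phi = nu o Phi o h has a nonzero difference of order
   n + 1; smoothing phi by differences of iterated antiderivatives and
   differentiating with respect to the dilation shows that t^(n+1) is in the
   closed affinely invariant span of phi. So lambda^n is in the closure of the
   span for all n, hence so is exp o lambda, and Stone-Weierstrass applies.
   For the last part, the vanishing of a difference of order n of nu o Phi with
   base point x and step h is a closed condition in each of x, h and nu, given by
   functions that are polynomial along lines: if it holds on an open set it holds
   everywhere. Baire's theorem is applied to x, then to h, then to nu. *)

(** * The Hahn-Banach theorem *)

Definition sublinear (R : realType) (V : lmodType R) (p : V -> R) :=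
  (forall x y, p (x + y) <= p x + p y) /\
  (forall (t : R) x, 0 < t -> p (t *: x) = t * p x).

Section Sublinear.
Context {R : realType} {V : lmodType R}.
Implicit Types (p q : V -> R) (x y : V).

Lemma sublinear0 p : sublinear p -> p 0 = 0.
Proof.
move=> [_ hp]; have := hp 2 0 (ltr0Sn _ _); rewrite scaler0; lra.
Qed.

Lemma sublinearN p x : sublinear p -> - p (- x) <= p x.
Proof.
move=> sp; have [sub _] := sp; have := sub x (- x).
by rewrite subrr (sublinear0 sp); lra.
Qed.

(** The hypothesis forces [p (- x) = - p x], so subadditivity at [(x, y)] and at [(- x, - y)] gives
    two opposite inequalities. *)
Lemma sublinearN_le_linear p : sublinear p -> (forall x, p x + p (- x) <= 0) ->
  linear (p : V -> R^o).
Proof.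
move=> sp np; have [sub hom] := sp.
have pN x : p (- x) = - p x.
  by have := np x; have := sublinearN x sp; lra.
have add x y : p (x + y) = p x + p y.
  have := sub x y; have := sub (- x) (- y); rewrite -opprD !pN; lra.
move=> a x y; rewrite add; congr (_ + _).
have [a0|a0|->] := ltgtP a 0.
- rewrite -[a in LHS]opprK scaleNr pN hom ?oppr_gt0//.
  by rewrite /GRing.scale /= mulNr opprK.
- by rewrite hom.
- by rewrite !scale0r sublinear0.
Qed.

(* Lowers p as far as possible in direction -y; a minimal sublinear functional is
   fixed by all these operations, which forces it to be linear. *)
Definition shave p y x := inf [set p (x + t *: y) - t * p y | t in [set t | 0 <= t]].

Section Shave.
Variables (p : V -> R) (sp : sublinear p) (y : V).

Let S x := [set p (x + t *: y) - t * p y | t in [set t | 0 <= t]].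

Let Slb x : lbound (S x) (- p (- x)).
Proof.
move=> _ [t t0 <-]; have [sub hom] := sp.
have := sub (- x) (x + t *: y); rewrite addKr.
have [t1|t1] := ltP 0 t; first by rewrite hom//; lra.
have -> : t = 0 by apply/le_anti/andP.
by rewrite scale0r (sublinear0 sp); lra.
Qed.

Let Sinf x : has_inf (S x).
Proof.
split; last by exists (- p (- x)); exact: Slb.
by exists (p (x + 0 *: y) - 0 * p y); exists 0 => /=.
Qed.

Lemma shave_le_at t x : 0 <= t -> shave p y x <= p (x + t *: y) - t * p y.
Proof. by move=> t0; apply: ge_inf; [case: (Sinf x)|exists t]. Qed.

Lemma shave_ge z x : (forall t, 0 <= t -> z <= p (x + t *: y) - t * p y) ->
  z <= shave p y x.
Proof.
move=> h; apply: lb_le_inf; first by case: (Sinf x).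
by move=> _ [t t0 <-]; exact: h.
Qed.

Lemma shave_le x : shave p y x <= p x.
Proof. by have := @shave_le_at 0 x (lexx 0); rewrite scale0r addr0; lra. Qed.

Lemma sublinear_shave : sublinear (shave p y).
Proof.
have [sub hom] := sp; split=> [a b|t x t0].
  rewrite -lerBlDr; apply: shave_ge => s s0.
  rewrite lerBlDl -lerBlDr; apply: shave_ge => r r0.
  rewrite lerBlDr.
  have := @shave_le_at (s + r) (a + b) (addr_ge0 s0 r0).
  have := sub (a + s *: y) (b + r *: y).
  by rewrite addrACA -scalerDl mulrDl; lra.
apply/le_anti/andP; split.
  rewrite -ler_pdivrMl//; apply: shave_ge => s s0.
  rewrite ler_pdivrMl//.
  have := @shave_le_at (t * s) (t *: x) (mulr_ge0 (ltW t0) s0).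
  by rewrite -scalerA -scalerDr hom// mulrBr mulrA.
apply: shave_ge => s s0.
have ts0 : 0 <= t^-1 * s by rewrite mulr_ge0// invr_ge0 ltW.
have := shave_le_at x ts0.
have -> : t *: x + s *: y = t *: (x + (t^-1 * s) *: y).
  by rewrite scalerDr scalerA mulVKf// gt_eqF.
by rewrite hom// -(ler_pM2l t0) mulrBr !mulrA mulfV ?gt_eqF// mul1r.
Qed.

End Shave.

(** Minimality makes [shave q x] equal to [q]; its bound at [- x] with [t = 1] then reads
    [q (- x) <= - q x]. *)
Lemma minimal_sublinear_linear q : sublinear q ->
  (forall r, sublinear r -> (forall x, r x <= q x) -> r = q) ->
  linear (q : V -> R^o).
Proof.
move=> sq qmin; apply: sublinearN_le_linear => // x.
have := shave_le_at sq x (- x) ler01.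
rewrite (qmin _ (sublinear_shave sq x) (shave_le sq x)).
rewrite scale1r addNr (sublinear0 sq); lra.
Qed.

(** Zorn's lemma for the reversed pointwise order. A chain is bounded by its pointwise infimum,
    finite because of the lower bound [- p (- x)], and subadditive because any two members are
    comparable. *)
Lemma exists_minimal_sublinear p : sublinear p -> exists q,
  [/\ sublinear q, forall x, q x <= p x &
      forall r, sublinear r -> (forall x, r x <= q x) -> r = q].
Proof.
move=> sp; pose T := {q : V -> R | sublinear q /\ forall x, q x <= p x}.
pose le_T (r s : T) := `[< forall x, sval s x <= sval r x >].
have [|r s t /asboolP rs /asboolP st|[s hs] [t ht] /asboolP st /asboolP ts|A totA|] :=
    @Zorn T le_T.
- by move=> t; apply/asboolP => x.
- by apply/asboolP => x; apply: le_trans (st x) (rs x).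
- apply: eq_exist => /=; apply/funext => x.
  by apply/le_anti; rewrite (st x) (ts x).
- have [[q0 Aq0]|nA] := pselect (exists t, A t); last first.
    exists (exist _ p (conj sp (fun x => lexx (p x)))) => s As.
    by exfalso; apply: nA; exists s.
  pose B x := [set sval t x | t in A].
  have B0 x : B x !=set0 by exists (sval q0 x); exists q0.
  have lB x : lbound (B x) (- p (- x)).
    move=> _ [[q [sq qp]] Aq <-] /=; have := sublinearN x sq; have := qp (- x); lra.
  have hB x : has_inf (B x) by split=> //; exists (- p (- x)).
  have infB t x : A t -> inf (B x) <= sval t x.
    by move=> At; apply: ge_inf; [case: (hB x)|exists t].
  have sinf : sublinear (fun x => inf (B x)).
    split=> [x y|t x t0].
      rewrite -lerBlDr; apply: lb_le_inf => // _ [q Aq <-].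
      rewrite lerBlDl -lerBlDr; apply: lb_le_inf => // _ [r Ar <-].
      rewrite lerBlDr.
      have [/asboolP qr|/asboolP rq] := totA _ _ Aq Ar.
        have := infB _ (x + y) Ar; have [[sub _] _] := svalP r.
        have := sub x y; have := qr x; lra.
      have := infB _ (x + y) Aq; have [[sub _] _] := svalP q.
      have := sub x y; have := rq y; lra.
    apply/le_anti/andP; split.
      rewrite -ler_pdivrMl//; apply: lb_le_inf => // _ [q Aq <-].
      rewrite ler_pdivrMl//; have [[_ hom] _] := svalP q.
      by rewrite -hom//; exact: infB.
    apply: lb_le_inf => // _ [q Aq <-].
    have [[_ hom] _] := svalP q.
    by rewrite hom// ler_pM2l//; exact: infB.
  have pinf x : inf (B x) <= p x.
    by apply: le_trans (infB _ x Aq0) _; case: (svalP q0).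
  exists (exist _ (fun x => inf (B x)) (conj sinf pinf)) => s As; apply/asboolP => x /=.
  exact: infB.
move=> [q [sq qp]] qmax; exists q; split=> // r sr rq.
have rp x : r x <= p x by apply: le_trans (qp x).
by apply: (congr1 sval (qmax (exist _ r (conj sr rp)) _)); apply/asboolP.
Qed.

(** A minimal functional [f] below [shave p e] satisfies [f (- e) <= - p e], which by linearity is
    the missing inequality [p e <= f e]. *)
Lemma hahn_banach_sublinear p e : sublinear p -> exists f : V -> R,
  [/\ linear (f : V -> R^o), forall x, f x <= p x & f e = p e].
Proof.
move=> sp.
have [f [sf fp fmin]] := exists_minimal_sublinear (sublinear_shave sp e).
exists f; split; first exact: minimal_sublinear_linear.
  by move=> x; apply: le_trans (fp x) (shave_le sp e x).
apply/le_anti/andP; split; first by apply: le_trans (fp e) (shave_le sp e e).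
have := fp (- e); have := shave_le_at sp e (- e) ler01.
rewrite scale1r addNr (sublinear0 sp); have := sublinearN e sf; lra.
Qed.

End Sublinear.

Lemma linear_sub (R : realType) (V W : lmodType R) (f : V -> W) (lf : linear f) x y :
  f (x - y) = f x - f y.
Proof. by rewrite addrC -scaleN1r lf scaleN1r addrC. Qed.

Lemma linear_zero (R : realType) (V W : lmodType R) (f : V -> W) (lf : linear f) :
  f 0 = 0.
Proof. by rewrite -[in LHS](subrr 0) linear_sub// subrr. Qed.

Lemma linear_scale (R : realType) (V W : lmodType R) (f : V -> W) (lf : linear f) a x :
  f (a *: x) = a *: f x.
Proof. by rewrite -[a *: x]addr0 lf (linear_zero lf) addr0. Qed.

Lemma convex_setP (R : realType) (V : lmodType R) (U : set V) : convex_set U ->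
  forall x y (t : R), U x -> U y -> 0 <= t <= 1 -> U (t *: x + (1 - t) *: y).
Proof.
move=> cU x y t Ux Uy t01.
have ht : Itv.spec (@Itv.num_sem R) (Itv.Real `[0%Z, 1%Z]) t.
  by rewrite /= /Itv.num_sem /= num_real /= in_itv /=.
have := cU x y (Itv.mk ht); rewrite !inE; exact.
Qed.

(** * The gauge (Minkowski functional) of a convex neighbourhood of 0 *)

Section Gauge.
Context {R : realType} {E : tvsType R}.
Variables (U : set E) (cU : convex_set U) (nU : nbhs 0 U).

Definition gauge (x : E) := inf [set r : R | 0 < r /\ U (r^-1 *: x)].

Let U0 : U 0. Proof. exact: nbhs_singleton. Qed.

Let scaleU x (r : R) : U x -> 0 <= r <= 1 -> U (r *: x).
Proof. by move=> Ux r01; have := convex_setP cU Ux U0 r01; rewrite scaler0 addr0. Qed.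

Let has_inf_gauge x : has_inf [set r : R | 0 < r /\ U (r^-1 *: x)].
Proof.
split; last by exists 0 => r [/ltW].
(* Scaling is continuous at [(0, x)], so U absorbs x. *)
have [B /= [B1 B2] BU] : nbhs ((0 : R^o), x) ((fun z : R^o * E => z.1 *: z.2) @^-1` U).
  by apply: scale_continuous; rewrite /= scale0r.
have [e /= e0 eB] := B1.
exists (e / 2)^-1; split; first by rewrite invr_gt0 divr_gt0.
rewrite invrK; apply: (BU (e / 2, x)); split => /=; last exact: nbhs_singleton.
by apply: eB; rewrite /= sub0r normrN gtr0_norm ?divr_gt0// ltr_pdivrMr// ltr_pMr// ltr1n.
Qed.

Lemma gauge_ge0 x : 0 <= gauge x.
Proof.
by apply: lb_le_inf; [case: (has_inf_gauge x)|move=> r [/ltW]].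
Qed.

Lemma gauge_lt_mem x (r : R) : gauge x < r -> U (r^-1 *: x).
Proof.
have [ne _] := has_inf_gauge x; move=> /(inf_lt ne) [s [s0 Us] sr].
have -> : r^-1 *: x = (r^-1 * s) *: (s^-1 *: x).
  by rewrite scalerA mulfK// gt_eqF.
have r0 := lt_trans s0 sr.
apply: scaleU => //; apply/andP; split.
  by rewrite mulr_ge0 ?invr_ge0 ?ltW.
by rewrite mulrC ler_pdivrMr// mul1r ltW.
Qed.

Lemma mem_gauge_le x (r : R) : 0 < r -> U (r^-1 *: x) -> gauge x <= r.
Proof. by move=> r0 Ur; apply: ge_inf => //; case: (has_inf_gauge x). Qed.

Lemma gauge_le1 x : U x -> gauge x <= 1.
Proof. by move=> Ux; apply: mem_gauge_le => //; rewrite invr1 scale1r. Qed.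

Lemma gauge_ge1 x : ~ U x -> 1 <= gauge x.
Proof.
by move=> nUx; rewrite leNgt; apply/negP => /gauge_lt_mem; rewrite invr1 scale1r.
Qed.

Lemma sublinear_gauge : sublinear gauge.
Proof.
have add x y : gauge (x + y) <= gauge x + gauge y.
  (* With r and s slightly above the two gauges, [(x + y) / (r + s)] is the convex combination of
     [x / r] and [y / s] with weight [r / (r + s)]. *)
  apply/ler_addgt0Pl => e e0.
  pose r := gauge x + e / 2; pose s := gauge y + e / 2.
  have e20 : 0 < e / 2 by rewrite divr_gt0.
  have r0 : 0 < r by rewrite ltr_wpDl ?gauge_ge0.
  have s0 : 0 < s by rewrite ltr_wpDl ?gauge_ge0.
  have -> : e + (gauge x + gauge y) = r + s by rewrite /r /s; lra.
  have rs0 : 0 < r + s by rewrite addr_gt0.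
  apply: mem_gauge_le => //.
  have Ur : U (r^-1 *: x) by apply: gauge_lt_mem; rewrite ltrDl.
  have Us : U (s^-1 *: y) by apply: gauge_lt_mem; rewrite ltrDl.
  have t01 : 0 <= r / (r + s) <= 1.
    by apply/andP; split; [rewrite divr_ge0 ?ltW|rewrite ler_pdivrMr// mul1r lerDl ltW].
  have := convex_setP cU Ur Us t01.
  rewrite !scalerA.
  have -> : r / (r + s) / r = (r + s)^-1 by field; rewrite !gt_eqF.
  have -> : (1 - r / (r + s)) / s = (r + s)^-1.
    by field; rewrite !gt_eqF.
  by rewrite -scalerDr.
have hom (t : R) x : 0 < t -> gauge (t *: x) <= t * gauge x.
  move=> t0; rewrite -ler_pdivrMl//; apply: lb_le_inf.
    by case: (has_inf_gauge x).
  move=> r [r0 Ur]; rewrite ler_pdivrMl//; apply: mem_gauge_le.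
    by rewrite mulr_gt0.
  by rewrite scalerA invfM mulrC mulrA mulfV ?gt_eqF// mul1r.
split=> // t x t0; apply/le_anti; rewrite hom//= -ler_pdivlMl//.
have := hom t^-1 (t *: x); rewrite invr_gt0 scalerA mulVf ?gt_eqF// scale1r.
exact.
Qed.

End Gauge.

(** * Continuous functionals separate points *)

Lemma nbhs_convex (R : realType) (E : tvsType R) (x : E) (A : set E) : nbhs x A ->
  exists2 U : set E, convex_set U & nbhs x U /\ U `<=` A.
Proof.
have [B cB [oB bB]] := @locally_convex R E.
move=> /bB [U [BU Ux] UA]; exists U; first by apply: cB; rewrite inE.
by split=> //; apply: open_nbhs_nbhs; split=> //; exact: oB.
Qed.

(** On the symmetric neighbourhood V, the intersection of U and -U, [|f| <= 1]; hence f varies by at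
    most e on [x + e V]. *)
Lemma bounded_linear_continuous (R : realType) (E : tvsType R) (f : E -> R^o)
    (U : set E) : linear f -> nbhs 0 U -> (forall x, U x -> f x <= 1) ->
  continuous f.
Proof.
move=> lf nU fU x.
have nV : nbhs 0 (U `&` (-%R @` U)) by apply: filterI => //; exact: nbhs0N.
have fV y : (U `&` (-%R @` U)) y -> `|f y| <= 1.
  move=> [Uy [z Uz zy]]; rewrite ler_norml fU// andbT -zy.
  have := fU _ Uz; rewrite -[- z]scaleN1r (linear_scale lf) scaleN1r; lra.
apply/(@cvgrPdist_le _ R^o) => e e0.
have := nbhsT x (nbhs0Z (lt0r_neq0 e0) nV); apply: filterS.
move=> _ [_ [v Vv <-] <-].
rewrite distrC -(linear_sub lf) addrAC subrr add0r (linear_scale lf) normrM (gtr0_norm e0).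
by rewrite ler_piMr ?fV// ltW.
Qed.

Lemma dual_linear (R : realType) (E : tvsType R) (nu : dual E) : linear nu.
Proof. by case: nu => f /=; rewrite inE => -[]. Qed.

Lemma dual_continuous (R : realType) (E : tvsType R) (nu : dual E) : continuous nu.
Proof. by case: nu => f /=; rewrite inE => -[]. Qed.

(** If x is nonzero, some convex neighbourhood of 0 misses it. A functional dominated by its gauge
    and equal to it at x is continuous, with value at least 1 at x. *)
Lemma dual_separates (R : realType) (E : tvsType R) (x : E) :
  hausdorff_space E -> (forall nu : dual E, nu x = 0) -> x = 0.
Proof.
move=> hE nux; apply: contrapT => /eqP x0.
have [A nA Ax] : exists2 A : set E, nbhs 0 A & ~ A x.
  apply: contrapT => h; move/eqP: x0; apply; apply/esym/hE => A B nA nB.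
  exists x; split; last exact: nbhs_singleton.
  by apply: contrapT => nAx; apply: h; exists A.
have [U cU [nU UA]] := nbhs_convex nA.
have [f [lf fg fx]] := hahn_banach_sublinear x (sublinear_gauge cU nU).
have cf : continuous (f : E -> R^o).
  apply: (bounded_linear_continuous lf nU) => y Uy.
  exact: le_trans (fg y) (gauge_le1 nU Uy).
have fP : f \in @continuous_functional R E by rewrite inE.
have := nux (Dual fP); rewrite /= fx => gx0.
have /(gauge_ge1 cU nU) : ~ U x by move=> /UA.
by rewrite gx0 ler10.
Qed.

(** * Finite differences and polynomials *)

Section FiniteDifferences.
Context {R : realType} {V W : lmodType R}.
Implicit Types (f g : V -> W) (x h : V) (s : seq V) (n : nat).

(** This is [(-1) ^+ n] times the usual forward difference. The explicit sum makes continuity and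
    compatibility with functionals termwise; [mdiff] is the iterated form, which allows different
    steps. *)
Definition fdiff n f x h : W :=
  \sum_(r < n.+1) ((-1) ^+ r * 'C(n, r)%:R) *: f (x + r%:R *: h).

Definition mdiff s f x : W :=
  foldr (fun h (g : V -> W) y => g (y + h) - g y) f s x.

End FiniteDifferences.

Section FiniteDifferencesTheory.
Context {R : realType} {V W : lmodType R}.
Implicit Types (f g : V -> W) (x h : V) (s : seq V) (n : nat).

Lemma mdiff_cons h s f x : mdiff (h :: s) f x = mdiff s f (x + h) - mdiff s f x.
Proof. by []. Qed.

Lemma mdiff_swap h s f : mdiff (h :: s) f = mdiff s (mdiff [:: h] f).
Proof.
elim: s => // k s IH; apply/funext => x.
rewrite !mdiff_cons -IH !mdiff_cons (addrAC x h k) !opprD !opprK.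
by rewrite [LHS]addrACA.
Qed.

Lemma mdiff_cat s t f : mdiff (s ++ t) f = mdiff s (mdiff t f).
Proof. by rewrite /mdiff; apply/funext => x; rewrite foldr_cat. Qed.

Lemma mdiffC s t f : mdiff s (mdiff t f) = mdiff t (mdiff s f).
Proof.
elim: t f => // h t IH f.
rewrite (mdiff_swap h t f) IH (mdiff_swap h t (mdiff s f)).
by rewrite -(mdiff_swap h s f).
Qed.

Lemma mdiff_perm s t f : perm_eq s t -> mdiff s f = mdiff t f.
Proof.
move=> st; apply: (catCA_perm_ind (P := fun u => mdiff s f = mdiff u f) _ st) => //.
by move=> u v w ->; rewrite !mdiff_cat mdiffC.
Qed.

Lemma mdiff0 s f x : 0 \in s -> mdiff s f x = 0.
Proof.
elim: s x => // h s IH x; rewrite inE mdiff_cons => /orP[/eqP <-|hs].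
  by rewrite addr0 subrr.
by rewrite !IH// subrr.
Qed.

Lemma mdiff_nseqE n f x h : fdiff n f x h = (-1) ^+ n *: mdiff (nseq n h) f x.
Proof.
elim: n x => [|n IH] x.
  by rewrite /fdiff big_ord1 expr0 mul1r bin0 scale1r scale0r addr0 scale1r.
have -> : fdiff n.+1 f x h = fdiff n f x h - fdiff n f (x + h) h.
  rewrite /fdiff big_ord_recl [X in X - _]big_ord_recl /= -sumrN -!addrA.
  rewrite !bin0; congr (_ + _).
  under eq_bigr => i _ do rewrite /bump /= add1n binS natrD mulrDr scalerDl.
  rewrite big_split /= big_ord_recr /= bin_small// mulr0 scale0r addr0.
  congr (_ + _); apply: eq_bigr => i _.
  rewrite exprS mulN1r mulNr scaleNr; do 3! congr (_ _).
  by rewrite -nat1r scalerDl scale1r addrA.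
by rewrite !IH -scalerBr -opprB scalerN exprS mulN1r scaleNr.
Qed.

(** A step [u + r v] is absorbed by replacing the base point y by [y + u] and the direction z by
    [z + v], so the relation survives differencing along steps that depend affinely on r. *)
Lemma mdiff_affine (n : nat) (c : nat -> R) f :
  (forall y z, \sum_(r < n) c r *: f (y + r%:R *: z) = 0) ->
  forall (l : seq (V * V)) y z,
    \sum_(r < n) c r *: mdiff [seq p.1 + r%:R *: p.2 | p <- l] f (y + r%:R *: z) = 0.
Proof.
move=> cf; elim=> [|[u v] l IH] y z; first exact: cf.
under eq_bigr => r _ do
  rewrite [map _ _]/= mdiff_cons scalerBr /= addrACA -scalerDr.
by rewrite sumrB !IH subrr.
Qed.

(* Djokovic's polarization: [h_j - r (h_j / j)] vanishes for [j = r], so among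
   the mixed differences along these vectors only the one for [r = 0] survives. *)
Lemma fdiff_mdiff0 n f : (forall x h, fdiff n f x h = 0) ->
  forall s, size s = n -> forall x, mdiff s f x = 0.
Proof.
move=> f0 s sn x.
pose l := [seq (nth 0 s j, - (j.+1%:R^-1 *: nth 0 s j)) | j <- iota 0 n].
have := @mdiff_affine n.+1 (fun r => (-1) ^+ r * 'C(n, r)%:R) f f0 l x 0.
rewrite big_ord_recl /= scaler0 addr0 bin0 expr0 mul1r scale1r big1 => [|i _].
  rewrite addr0 => <-; congr (mdiff _ _ _).
  rewrite /l -map_comp -[s in LHS](mkseq_nth 0) sn; apply: eq_map => j /=.
  by rewrite scale0r addr0.
rewrite mdiff0 ?scaler0//; apply/mapP; exists (nth 0 s i, - (i.+1%:R^-1 *: nth 0 s i)).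
  by apply/mapP; exists (i : nat) => //; rewrite mem_iota /=.
by rewrite /= /bump /= add1n scalerN scalerA divff ?pnatr_eq0// scale1r subrr.
Qed.

End FiniteDifferencesTheory.

(** The difference of order n of [t ^+ i] at 0 with step 1. Induction:
    [(r+1) C(n+1, r+1) = (n+1) C(n, r)] removes one power, and expanding [(r+1)^i] returns to order
    n. *)
Lemma sum_signed_bin_pow (R : comNzRingType) n i : (i <= n)%N ->
  \sum_(r < n.+1) (-1) ^+ r * 'C(n, r)%:R * r%:R ^+ i =
  (if i == n then (-1) ^+ n * n`!%:R else 0) :> R.
Proof.
elim: n i => [|n IH] [|i] //= ile.
- by rewrite big_ord1 bin0 fact0 !expr0 !mulr1.
- have := exprDn (1 : R) (-1) n.+1; rewrite subrr exprS mul0r => e; rewrite [RHS]e.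
  by apply: eq_bigr => r _; rewrite expr0 mulr1 expr1n mul1r mulr_natr.
rewrite big_ord_recl /= expr0n /= mulr0 add0r.
transitivity (- n.+1%:R * \sum_(r < n.+1) (-1) ^+ r * 'C(n, r)%:R * r.+1%:R ^+ i : R).
  rewrite mulr_sumr; apply: eq_bigr => r _.
  rewrite /bump /= add1n [_ ^+ i.+1]exprS.
  have : ('C(n.+1, r.+1)%:R * r.+1%:R : R) = n.+1%:R * 'C(n, r)%:R.
    by rewrite -!natrM mulnC -mul_bin_diag.
  rewrite exprS.
  move: ('C(n.+1, r.+1)%:R) ('C(n, r)%:R) ((-1) ^+ r) n.+1%:R (r.+1%:R) (r.+1%:R ^+ i).
  move=> a b c f e d abef; transitivity (- c * d * (a * e)); first by ring.
  by rewrite abef; ring.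
transitivity (- n.+1%:R * \sum_(l < i.+1) 'C(i, l)%:R *
    \sum_(r < n.+1) (-1) ^+ r * 'C(n, r)%:R * r%:R ^+ l : R).
  congr (_ * _); under [RHS]eq_bigr do rewrite mulr_sumr.
  rewrite exchange_big /=; apply: eq_bigr => r _.
  rewrite -nat1r exprDn mulr_sumr; apply: eq_bigr => l _.
  by rewrite expr1n mul1r -[(_ ^+ l) *+ _]mulr_natl mulrCA.
rewrite big_ord_recr /= binn mul1r big1 ?add0r => [|l _]; last first.
  rewrite IH; last by rewrite -ltnS (leq_trans (ltn_ord l))// ltnW.
  by rewrite ltn_eqF ?mulr0// (leq_trans (ltn_ord l)).
rewrite IH// eqSS; case: ifP => _; last by rewrite mulr0.
by rewrite factS natrM exprS mulN1r !mulNr mulrCA.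
Qed.

Lemma poly_eq0_inj (R : idomainType) (p : {poly R}) (u : nat -> R) :
  injective u -> (forall n, p.[u n] = 0) -> p = 0.
Proof.
move=> uinj pu; apply/eqP/negPn/negP => p0.
have := @max_poly_roots _ p [seq u i | i <- iota 0 (size p)] p0.
rewrite map_inj_uniq ?iota_uniq// size_map size_iota ltnn => h.
suff : false by []; apply: h => //.
by apply/allP => _ /mapP[n _ ->]; rewrite rootE pu.
Qed.

Lemma natr_inj (R : numDomainType) : injective (fun n => n%:R : R).
Proof. by move=> m n /eqP; rewrite eqr_nat => /eqP. Qed.

Lemma additive_poly (R : numDomainType) (p : {poly R}) :
  (forall s t, p.[s + t] = p.[s] + p.[t]) -> forall t, p.[t] = t * p.[1].
Proof.
move=> pD t; have p0 : p.[0] = 0.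
  by have /(congr1 (fun z => z - p.[0])) := pD 0 0; rewrite addr0 subrr addrK.
suff /eqP : p - p.[1] *: 'X = 0.
  by rewrite subr_eq0 => /eqP e; rewrite [in LHS]e !hornerE mulrC.
apply: (poly_eq0_inj (@natr_inj R)) => n; rewrite !hornerE.
have -> : p.[n%:R] = n%:R * p.[1].
  elim: n => [|n IH]; first by rewrite p0 mul0r.
  by rewrite -natr1 pD IH mulrDl mul1r.
by rewrite mulrC subrr.
Qed.

Section Lines.
Context {R : realType} {V W : lmodType R}.
Implicit Types (f g : V -> W) (x h : V) (n : nat).

Lemma fdiff_line n (c : nat -> W) f x h :
  (forall t, f (x + t *: h) = \sum_(i < n.+1) t ^+ i *: c i) ->
  fdiff n f x h = ((-1) ^+ n * n`!%:R) *: c n.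
Proof.
move=> fE; rewrite /fdiff; under eq_bigr do rewrite fE scaler_sumr.
rewrite exchange_big /= big_ord_recr /= big1 ?add0r => [|i _].
  under eq_bigr do rewrite scalerA.
  by rewrite -scaler_suml sum_signed_bin_pow// eqxx.
under eq_bigr do rewrite scalerA.
by rewrite -scaler_suml sum_signed_bin_pow ?ltn_eqF ?scale0r// ltnW.
Qed.

Lemma fdiff_line0 m n (c : nat -> W) f x h : (m <= n)%N ->
  (forall t, f (x + t *: h) = \sum_(i < m) t ^+ i *: c i) ->
  fdiff n f x h = 0.
Proof.
move=> mn fE.
rewrite (@fdiff_line n (fun i => if (i < m)%N then c i else 0)) => [|t].
  by rewrite ltnNge mn scaler0.
rewrite fE (big_ord_widen n.+1 (fun i => t ^+ i *: c i)) ?(leq_trans mn)//.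
by rewrite big_mkcond; apply: eq_bigr => i _; case: ifP; rewrite ?scaler0.
Qed.

Lemma fdiffB n f g x h :
  fdiff n (fun v => f v - g v) x h = fdiff n f x h - fdiff n g x h.
Proof. by rewrite /fdiff -sumrB; apply: eq_bigr => i _; rewrite scalerBr. Qed.

(** By linearity in the first argument, the value is the form with that argument frozen at x plus t
    times the form with it frozen at h. Both have one argument fewer; the second supplies the top
    coefficient. *)
Lemma multilinear_line k (M : ('I_k -> V) -> W) x h : multilinear M ->
  exists c : nat -> W,
    (forall t, M (fun=> x + t *: h) = \sum_(i < k.+1) t ^+ i *: c i) /\
    c k = M (fun=> h).
Proof.
elim: k M => [|k IH] M mM.
  exists (fun=> M (fun=> h)); split=> // t.
  by rewrite big_ord1 expr0 scale1r; congr M; apply/funext => -[].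
pose cons (v : V) (y : 'I_k -> V) := fun j => if unlift ord0 j is Some i then y i else v.
have mcons v : multilinear (M \o cons v).
  move=> i y a u w.
  suff E u' : cons v (fun j => if j == i then u' else y j) =
    (fun j => if j == lift ord0 i then u' else cons v y j).
    by rewrite /= !E; exact: mM.
  apply/funext => j; rewrite /cons; case: unliftP => [j' ->|->].
    by rewrite (inj_eq lift_inj); case: eqP.
  by rewrite eq_sym -[_ == _]negbK eq_sym neq_lift.
have lcons y : linear (fun v => M (cons v y)).
  move=> a u w.
  suff E u' : cons u' y = (fun j => if j == ord0 then u' else cons 0 y j).
    by rewrite (E u) (E w) (E (a *: u + w)); exact: mM.
  by apply/funext => j; rewrite /cons; case: unliftP => [j' ->|->].
have consE v : cons v (fun=> v) = fun=> v.
  by apply/funext => j; rewrite /cons; case: unlift.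
have [c [cE _]] := IH _ (mcons x); have [d [dE dk]] := IH _ (mcons h).
exists (fun i => (if (i <= k)%N then c i else 0) + (if i is j.+1 then d j else 0)).
split; last by rewrite ltnn add0r dk /= consE.
move=> t; rewrite -consE [in X in cons X]addrC lcons addrC.
rewrite [M _](cE t) [M _](dE t).
under [RHS]eq_bigr do rewrite scalerDr; rewrite big_split /=; congr (_ + _).
  rewrite [RHS]big_ord_recr /= ltnn scaler0 addr0; apply: eq_bigr => i _.
  by rewrite -ltnS ltn_ord.
rewrite [RHS]big_ord_recl scaler0 add0r scaler_sumr; apply: eq_bigr => i _.
by rewrite scalerA -exprS.
Qed.

Lemma is_polynomial_line f : is_polynomial f -> exists n, forall x h,
  exists c : nat -> W, forall t, f (x + t *: h) = \sum_(i < n.+1) t ^+ i *: c i.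
Proof.
move=> [n [M0 [M [mM fE]]]]; exists n => x h.
have /choice[c cE] : forall k, exists c : nat -> W, (1 <= k <= n)%N ->
    forall t, M k (fun=> x + t *: h) = \sum_(i < n.+1) t ^+ i *: c i.
  move=> k; have [kn|kn] := boolP (1 <= k <= n)%N; last by exists (fun=> 0).
  have [mk _] := mM _ kn; have [c [cE _]] := multilinear_line x h mk.
  exists (fun i => if (i < k.+1)%N then c i else 0) => _ t; rewrite cE.
  rewrite (big_ord_widen n.+1 (fun i => t ^+ i *: c i)); last by case/andP: kn.
  by rewrite big_mkcond; apply: eq_bigr => i _; case: ifP; rewrite ?scaler0.
exists (fun i => (if i == 0 then M0 else 0) + \sum_(1 <= k < n.+1) c k i) => t.
under eq_bigr do rewrite scalerDr; rewrite big_split /= fE; congr (_ + _).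
  by rewrite big_ord_recl /= expr0 scale1r big1 ?addr0// => i _; rewrite scaler0.
under eq_bigr do rewrite scaler_sumr; rewrite exchange_big /=.
by rewrite big_nat [RHS]big_nat; apply: eq_bigr => k kn; rewrite cE.
Qed.

End Lines.

Lemma linear_lincomb_line (R : realType) (W : lmodType R) (nu : W -> R^o) n (c : nat -> W) t :
  linear nu -> nu (\sum_(i < n) t ^+ i *: c i) = (\poly_(i < n) nu (c i)).[t].
Proof.
move=> lnu; rewrite horner_poly; elim/big_rec2: _ => [|i y z _ <-].
  exact: linear_zero.
by rewrite lnu mulrC.
Qed.

Section FdiffPolynomial.
Context {R : realType} {V W : lmodType R}.
Variables (N : set (W -> R^o)) (Nlin : forall nu, N nu -> linear nu).
Hypothesis Nsep : forall w, (forall nu, N nu -> nu w = 0) -> w = 0.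
Implicit Types (f g : V -> W) (x h : V) (n : nat).

(** A weak regularity assumption, tested through N: it promotes additivity of the mixed differences,
    which alone gives only rational homogeneity, to real homogeneity. *)
Definition line_poly f := forall nu, N nu -> forall x h,
  exists p : {poly R}, forall t, nu (f (x + t *: h)) = p.[t].

Lemma line_poly_mdiff s f : line_poly f -> line_poly (mdiff s f).
Proof.
move=> pf; elim: s => // k s IH nu Nnu x h.
have [p pE] := IH _ Nnu (x + k) h; have [q qE] := IH _ Nnu x h.
exists (p - q) => t; rewrite mdiff_cons (linear_sub (Nlin Nnu)) qE.
by rewrite [x + _ + k]addrAC pE hornerD hornerN.
Qed.

(** For f polynomial of degree at most k, this is the polarization of its homogeneous part of degree
    k. *)
Definition mdiff_form k f (x : 'I_k -> V) : W :=
  (k`!%:R)^-1 *: mdiff [seq x i | i <- enum 'I_k] f 0.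

Lemma mdiff_form_sym k f : symmetric_map (mdiff_form (k := k) f).
Proof.
move=> s x; rewrite /mdiff_form; congr (_ *: _).
have -> : [seq (x \o s) i | i <- enum 'I_k] = map x (map s (enum 'I_k)).
  by rewrite -[RHS]map_comp; apply: eq_map.
rewrite (@mdiff_perm _ _ _ (map x (map s (enum 'I_k))) (map x (enum 'I_k)))//.
apply: perm_map; apply: uniq_perm; rewrite ?enum_uniq//.
  by rewrite map_inj_uniq ?enum_uniq//; exact: perm_inj.
move=> i; rewrite mem_enum; apply/mapP; exists (s^-1%g i); first by rewrite mem_enum.
by rewrite permKV.
Qed.

Lemma mdiff_form_multilinear n f : line_poly f ->
  (forall x h, fdiff n.+2 f x h = 0) -> multilinear (mdiff_form (k := n.+1) f).
Proof.
move=> pf f0 i x.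
pose s := [seq x j | j <- rem i (enum 'I_n.+1)].
have sn : size s = n.
  by rewrite size_map size_rem ?mem_enum// size_enum_ord.
pose L v := mdiff (v :: s) f 0.
have LE v : mdiff_form f (fun j => if j == i then v else x j) = (n.+1`!%:R)^-1 *: L v.
  rewrite /mdiff_form; congr (_ *: _); rewrite /L.
  have /(perm_map (fun j => if j == i then v else x j)) :=
    perm_to_rem (mem_enum 'I_n.+1 i : i \in enum 'I_n.+1 = true).
  move=> /mdiff_perm ->; rewrite /= eqxx /s; congr (mdiff (_ :: _) _ _).
  apply/eq_in_map => j; rewrite mem_rem_uniq ?enum_uniq// inE /= => /andP[/negPf ->].
  by [].
(* Additivity is the vanishing at 0 of the difference of order [n + 2] along u, v and s. *)
have LD u v : L (u + v) = L u + L v.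
  have /eqP := fdiff_mdiff0 f0 (s := [:: u, v & s]) (congr1 S (congr1 S sn)) 0.
  rewrite /L !mdiff_cons !add0r subr_eq0 => /eqP <-.
  by rewrite [RHS]addrC addrA subrK.
(* Under each functional, [L (t *: v)] is an additive polynomial in t, hence a multiple of t. *)
have L1 (t : R) v : L (t *: v) = t *: L v.
  apply/eqP; rewrite -subr_eq0; apply/eqP/Nsep => nu Nnu.
  have [p pE] : exists p : {poly R}, forall t, nu (L (t *: v)) = p.[t].
    have [p pE] := line_poly_mdiff s pf Nnu 0 v.
    exists (p - (p.[0])%:P) => r; rewrite hornerD hornerN hornerC -!pE scale0r.
    by rewrite /L mdiff_cons (linear_sub (Nlin Nnu)) addr0.
  rewrite (linear_sub (Nlin Nnu)) (linear_scale (Nlin Nnu)) pE.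
  rewrite additive_poly => [|r r']; first by rewrite -pE scale1r subrr.
  rewrite -!pE scalerDl LD -[in LHS](scale1r (L _)) (Nlin Nnu).
  by rewrite scale1r.
by move=> a u v; rewrite /= !LE LD L1 scalerDr !scalerA mulrC.
Qed.

(** Induction on the order: subtracting the diagonal of the top form D cancels the highest
    differences, so the remainder falls under the induction hypothesis. *)
Theorem fdiff_polynomial n f : line_poly f ->
  (forall x h, fdiff n.+1 f x h = 0) -> exists M0 (M : forall k, ('I_k -> V) -> W),
    (forall k, (1 <= k <= n)%N -> multilinear (M k) /\ symmetric_map (M k)) /\
    (forall v, f v = M0 + \sum_(1 <= k < n.+1) M k (fun=> v)).
Proof.
elim: n f => [|n IH] f pf f0.
  exists (f 0), (fun k _ => 0); split=> [k|v]; first by case: k.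
  rewrite big_geq// addr0; have := f0 0 v; rewrite /fdiff big_ord_recl big_ord1 /=.
  rewrite scale0r addr0 !bin0 binn expr0 expr1 !mulr1 scale1r scaleN1r scale1r add0r.
  by move=> /eqP; rewrite subr_eq0 => /eqP ->.
pose D := mdiff_form (k := n.+1) f.
have mD : multilinear D := mdiff_form_multilinear pf f0.
have [|x h|M0 [M [mM fE]]] := IH (fun v => f v - D (fun=> v)).
- move=> nu Nnu x h; have [p pE] := pf _ Nnu x h.
  have [c [cE _]] := multilinear_line x h mD.
  exists (p - \poly_(i < n.+2) nu (c i)) => t.
  rewrite (linear_sub (Nlin Nnu)) pE hornerD hornerN; congr (_ - _).
  by rewrite cE (linear_lincomb_line n.+2 c t (Nlin Nnu)).
- rewrite fdiffB; have [c [cE cn]] := multilinear_line x h mD.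
  rewrite (@fdiff_line _ _ _ n.+1 c (fun v => D (fun=> v)) x h cE) cn mdiff_nseqE.
  rewrite -scalerA -scalerBr /D /mdiff_form scalerA.
  rewrite mulfV ?pnatr_eq0 -?lt0n ?fact_gt0// scale1r.
  have -> : [seq h | _ <- enum 'I_n.+1] = nseq n.+1 h.
    by rewrite -[in RHS](size_enum_ord n.+1); elim: (enum _) => //= ? ? ->.
  (* One more difference, along x, vanishes: the difference of order [n + 1] with step h is the same
     at x as at 0. *)
  have := fdiff_mdiff0 f0 (s := x :: nseq n.+1 h) (congr1 S (size_nseq n.+1 h)) 0.
  by rewrite mdiff_cons add0r => ->; rewrite scaler0.
pose M' k := if k == n.+1 then mdiff_form (k := k) f else M k.
exists M0, M'; split=> [k /andP[k1]|v].
  rewrite leq_eqVlt /M'; case: eqP => [-> _|_ /= kn].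
    by split=> //; exact: mdiff_form_sym.
  by apply: mM; rewrite k1.
rewrite big_nat_recr//= addrA; have /eqP := fE v; rewrite subr_eq => /eqP ->.
congr (_ + _ + _); last by rewrite /M' eqxx.
by apply: eq_big_nat => k /andP[_ kn]; rewrite /M' ltn_eqF.
Qed.

End FdiffPolynomial.

(** * Continuous functions with vanishing differences *)

Section Interpolation.
Context {R : realType}.
Implicit Types (f : R -> R).

(** Newton's scheme: the value at a new node is adjusted by a multiple of the product w, which
    vanishes at the earlier nodes. *)
Lemma lagrange_interpolation (n : nat) (u v : nat -> R) : injective u ->
  exists2 p : {poly R}, (size p <= n)%N & forall i, (i < n)%N -> p.[u i] = v i.
Proof.
move=> uinj; elim: n => [|n [p sp pE]]; first by exists 0; rewrite ?size_poly0.
pose w : {poly R} := \prod_(i < n) ('X - (u i)%:P).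
have wn : w.[u n] != 0.
  rewrite /w horner_prod; apply/prodf_neq0 => i _.
  by rewrite !hornerE subr_eq0 (inj_eq uinj) gtn_eqF.
exists (p + ((v n - p.[u n]) / w.[u n]) *: w) => [|i].
  rewrite (leq_trans (size_polyD _ _))// geq_max (leq_trans sp)//=.
  rewrite (leq_trans (size_scale_leq _ _))// /w size_prod_XsubC.
  by rewrite /index_enum -enumT size_enum_ord.
rewrite ltnS leq_eqVlt hornerD hornerZ => /orP[/eqP ->|lin].
  by rewrite divfK// addrC subrK.
have wi : w.[u i] = 0.
  by rewrite /w horner_prod (bigD1 (Ordinal lin))//= !hornerE subrr mul0r.
by rewrite pE// wi mulr0 addr0.
Qed.

Lemma fdiff_poly0 (p : {poly R}) n (x h : R) : (size p <= n)%N ->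
  fdiff n (fun t : R^o => p.[t] : R^o) x h = 0.
Proof.
move=> pn; pose q := p \Po (h *: 'X + x%:P).
have sq : (size q <= n)%N.
  rewrite /q; apply: leq_trans pn; have [->|p0] := eqVneq p 0; first by rewrite comp_poly0.
  apply: leq_trans (size_comp_poly_leq _ _) _.
  rewrite -[leqRHS]prednK ?size_poly_gt0// ltnS -[leqRHS]muln1 leq_mul2l.
  have : (size (h *: 'X + x%:P)%R <= 2)%N.
    rewrite (leq_trans (size_polyD _ _))// geq_max.
    rewrite (leq_trans (size_scale_leq _ _)) ?size_polyX//.
    by rewrite (leq_trans (size_polyC_leq1 _)).
  by move=> s2; apply/orP; right; case: (size _) s2.
apply: (@fdiff_line0 _ _ _ n n (fun i => q`_i)) => // t.
transitivity q.[t].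
  by rewrite /q horner_comp !hornerE mulrC addrC.
rewrite (horner_coef_wide _ sq); apply: eq_bigr => i _.
by rewrite /GRing.scale /= mulrC.
Qed.

(** A vanishing difference of order n is a linear recurrence giving each lattice value from the n
    preceding ones; here the initial values are zero. *)
Lemma fdiff_lattice0 n f (x h : R) : (forall y, fdiff n (f : R^o -> R^o) y h = 0) ->
  (forall i, (i < n)%N -> f (x + i%:R * h) = 0) -> forall i, f (x + i%:R * h) = 0.
Proof.
move=> df f0 i; elim/ltn_ind: i => i IH; have [|ni] := ltnP i n; first exact: f0.
have := df (x + (i - n)%:R * h); rewrite /fdiff big_ord_recr big1 => [/=|j _].
  rewrite add0r binn mulr1 -addrA -mulrDl -natrD subnK// => /eqP.
  by rewrite scaler_eq0 signr_eq0 => /eqP.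
rewrite -addrA -mulrDl -natrD IH ?scaler0//.
by have := ltn_ord j; rewrite /=; lia.
Qed.

Lemma fdiff_lattice_poly n f (x h : R) : h != 0 ->
  (forall y, fdiff n (f : R^o -> R^o) y h = 0) ->
  exists2 p : {poly R}, (size p <= n)%N & forall i, f (x + i%:R * h) = p.[x + i%:R * h].
Proof.
move=> h0 df; have [i j|p sp pE] := @lagrange_interpolation n
    (fun i => x + i%:R * h) (fun i => f (x + i%:R * h)).
  by move=> /addrI /(mulIf h0) /natr_inj.
exists p => // i; apply/eqP; rewrite -subr_eq0; apply/eqP.
apply: (@fdiff_lattice0 n (fun t => f t - p.[t])) => [y|j jn]; last first.
  by rewrite pE// subrr.
by rewrite (@fdiffB _ R^o R^o n f) df fdiff_poly0// subrr.
Qed.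

(* The interpolants on the lattices -M + Z/d all agree on the natural numbers,
   so they are one and the same polynomial. *)
Theorem continuous_fdiff_poly n f : continuous (f : R^o -> R^o) ->
  (forall x h, fdiff n (f : R^o -> R^o) x h = 0) ->
  exists2 p : {poly R}, (size p <= n)%N & forall t, f t = p.[t].
Proof.
move=> cf df.
have [p sp pE] := @fdiff_lattice_poly n f 0 1 (oner_neq0 _) (fun y => df y 1).
exists p => //.
have pnat i : f i%:R = p.[i%:R] by have := pE i; rewrite add0r mulr1.
have prat (q : rat) : f (ratr q) = p.[ratr q].
  pose M := `|numq q|%N; pose d := `|denq q|%N.
  have d0 : (d%:R : R) != 0 by rewrite pnatr_eq0 absz_eq0 denq_neq0.
  have [r sr rE] := @fdiff_lattice_poly n f (- M%:R) d%:R^-1 (invr_neq0 d0) (fun y => df y _).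
  have -> : p = r.
    apply/eqP; rewrite -subr_eq0; apply/eqP/(poly_eq0_inj (@natr_inj R)) => i.
    rewrite hornerD hornerN -pnat.
    have -> : (i%:R : R) = - M%:R + ((M + i) * d)%:R * d%:R^-1.
      by rewrite natrM mulfK// natrD addKr.
    by rewrite -rE subrr.
  (* [q = - M + k / d] with [k = numq q + M d], which is nonnegative since [M = |numq q|] and
     [d >= 1]: so q lies on the lattice. *)
  have [k kE] : exists k : nat, numq q + (M * d)%:Z = k%:Z.
    exists (absz (numq q + (M * d)%:Z)); rewrite gez0_abs//.
    have : numq q >= - M%:Z by rewrite /M abszE lerNl -normrN ler_norm.
    have : (M <= M * d)%N by rewrite leq_pmulr// lt0n absz_eq0 denq_neq0.
    by move: (M * d)%N => e; lia.
  have -> : ratr q = - M%:R + k%:R * d%:R^-1 :> R.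
    have -> : (k%:R : R) = (numq q)%:~R + (M * d)%:R.
      by rewrite -[k%:R]/(k%:Z%:~R) -kE rmorphD.
    rewrite natrM mulrDl mulfK// addrC addrK /ratr; congr (_ / _).
    by rewrite /d -[RHS]/((`|denq q|%N%:Z)%:~R) gez0_abs.
  exact: rE.
move=> t; apply: contrapT => /eqP ft.
have ct : continuous (fun t : R^o => f t - p.[t] : R^o).
  move=> x; apply: cvgB; first exact: cf.
  exact: continuous_horner.
have [||x [/= xne [q _ qx]]] := @dense_rat R [set t | f t - p.[t] != 0].
- by exists t; rewrite /= subr_eq0.
- by apply: (@open_comp R^o R^o (fun t => f t - p.[t]) [set y | y != 0]);
    [move=> x _; exact: ct|exact: open_neq].
by move: xne; rewrite -qx prat subrr eqxx.
Qed.

End Interpolation.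

(** * Monomials in translation and dilation invariant spaces *)

Section RealAnalysis.
Context {R : realType}.
Implicit Types (f F : R -> R).

(** The mean value theorem for h of either sign, locating z only up to [|h|]. *)
Lemma increment_eq F f (x h : R) :
  (forall y, `|y - x| <= `|h| -> is_derive y (1 : R) F (f y)) ->
  exists2 z, `|z - x| <= `|h| & F (x + h) - F x = h * f z.
Proof.
have [h0|h0|->] := ltgtP h 0 => dF; last first.
- by exists x; rewrite ?subrr ?normr0 ?addr0 ?subrr ?mul0r.
- have [|||z] := @MVT_segment R F f x (x + h).
  + by rewrite lerDl ltW.
  + move=> y; rewrite in_itv /= => /andP[xy yx]; apply: dF.
    by rewrite !gtr0_norm ?subr_gt0//; lra.
  + apply: derivable_within_continuous => y; rewrite in_itv /= => /andP[xy yx].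
    have : is_derive y (1 : R) F (f y) by apply: dF; rewrite (gtr0_norm h0) ger0_norm; lra.
    by case.
  + rewrite in_itv /= => /andP[xz zx] ->.
    exists z; first by rewrite (gtr0_norm h0) ger0_norm; lra.
    by rewrite addrAC subrr add0r mulrC.
- have [|||z] := @MVT_segment R F f (x + h) x.
  + by rewrite gerDl ltW.
  + move=> y; rewrite in_itv /= => /andP[xy yx]; apply: dF.
    by rewrite !ltr0_norm ?subr_lt0//; lra.
  + apply: derivable_within_continuous => y; rewrite in_itv /= => /andP[xy yx].
    have : is_derive y (1 : R) F (f y) by apply: dF; rewrite (ltr0_norm h0) ler0_norm; lra.
    by case.
  + rewrite in_itv /= => /andP[xz zx] e.
    exists z; first by rewrite (ltr0_norm h0) ler0_norm; lra.
    by rewrite -opprB e; ring.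
Qed.

Lemma local_antiderivative f (M : R) : continuous f ->
  exists F, forall x, `|x| < M -> is_derive x (1 : R) F (f x).
Proof.
move=> cf; exists (fun x => \int[lebesgue_measure]_(t in [set` `[- M, x]]) f t)%R => x xM.
have [Mx xM'] : - M < x /\ x < M by apply/andP; rewrite -ltr_norml.
have [||d <-] := @continuous_FTC1_closed R f (- M) x M xM' _ Mx.
- apply: continuous_compact_integrable; first exact: segment_compact.
  exact: continuous_subspaceT.
- exact: cf.
- by rewrite derive1E; apply: DeriveDef.
Qed.

(** Antiderivatives on [(-M, M)] that vanish at 0 agree on overlaps. They are glued by using, at
    each x, an integer bound above [|x|]; near x one fixed index N computes the same values. *)
Lemma exists_antiderivative f : continuous f ->
  exists F, forall x, is_derive x (1 : R) F (f x).
Proof.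
move=> cf.
have /choice[G GE] : forall M : nat, exists F, F 0 = 0 /\
    forall x, `|x| < M%:R -> is_derive x (1 : R) F (f x).
  move=> M; have [F dF] := local_antiderivative M%:R cf.
  exists (fun x => F x - F 0); split=> [|x xM]; first by rewrite subrr.
  have := dF x xM => ?.
  by rewrite -[f x]subr0; apply: is_deriveB.
have GG (M N : nat) x : `|x| < M%:R -> `|x| < N%:R -> G M x = G N x.
  move=> xM xN; have [GM0 dGM] := GE M; have [GN0 dGN] := GE N.
  have [|z _] := @increment_eq (fun y => G M y - G N y) (fun=> 0) 0 x.
    move=> y; rewrite subr0 => yx.
    have ? := dGM y (le_lt_trans yx xM); have ? := dGN y (le_lt_trans yx xN).
    by rewrite -[0](subrr (f y)); apply: is_deriveB.
  rewrite add0r GM0 GN0 subrr subr0 mulr0 => /eqP.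
  by rewrite subr_eq0 => /eqP.
exists (fun x => G (Num.bound `|x|) x) => x.
pose N := Num.bound (`|x| + 1).
have xN : `|x| + 1 < N%:R by apply: archi_boundP; rewrite addr_ge0.
apply: (@near_eq_is_derive _ _ _ (G N)); last first.
  by apply: (GE N).2; apply: lt_trans xN; rewrite ltrDl.
near=> y; apply: GG; last exact: archi_boundP.
apply: lt_trans xN; rewrite -ltrBlDl; apply: le_lt_trans (lerB_dist _ _) _.
near: y; exact: (@cvgr_distC_lt _ _ _ _ _ id x (@cvg_id _ _) 1 ltr01).
Unshelve. all: by end_near. Qed.

(** Heine-Cantor, with only x confined to the segment: y may leave it. *)
Lemma segment_unif_continuous f (M e : R) : continuous f -> 0 < e ->
  exists2 d, 0 < d & forall x y, `|x| <= M -> `|x - y| <= d -> `|f x - f y| <= e.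
Proof.
move=> cf e0.
have := @segment_compact R (- M) M => /compact_near_coveringP.
move=> /(_ R (0 : R)^'+ (fun d x => forall y, `|x - y| <= d -> `|f x - f y| <= e) _) [].
  move=> x _; have := cf x => /cvgrPdist_le /(_ (e / 2)).
  rewrite divr_gt0// => /(_ isT) [r /= r0 rf].
  exists (ball x (r / 2), [set d | d < r / 2]).
    split => /=; first by apply: nbhsx_ballx; rewrite divr_gt0.
    by apply: nbhs_right_lt; rewrite divr_gt0.
  move=> [z d] /= [xz dr] y zy.
  have fz : `|f x - f z| <= e / 2 by apply: rf; rewrite /ball /= in xz *; lra.
  have fy : `|f x - f y| <= e / 2.
    apply: rf; rewrite /= -(subrK z x) -addrA.
    by apply: le_lt_trans (ler_normD _ _) _; rewrite /ball /= in xz *; lra.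
  rewrite -(subrK (f x) (f z)) -addrA; apply: le_trans (ler_normD _ _) _.
  by rewrite distrC; lra.
move=> d /= d0 dP; exists (d / 2); first by rewrite divr_gt0.
move=> x y xM xy; apply: (dP (d / 2)) => //=.
- by rewrite sub0r normrN gtr0_norm ?divr_gt0// ltr_pdivrMr// ltr_pMr// ltr1n.
- by rewrite divr_gt0.
- by rewrite in_itv /= -ler_norml.
Qed.

End RealAnalysis.

Section Monomials.
Context {R : realType}.
Variable V : set (R -> R).
Hypothesis VD : forall f g, V f -> V g -> V (fun x => f x + g x).
Hypothesis VZ : forall a f, V f -> V (fun x => a * f x).
Hypothesis Vaff : forall s c f, V f -> V (fun x => f (c + s * x)).
Hypothesis Vcl : forall f, (forall M e : R, 0 < e ->
  exists2 g, V g & forall x, `|x| <= M -> `|f x - g x| <= e) -> V f.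
Implicit Types (f F : R -> R).

Let Vsum f0 n (F : 'I_n -> R -> R) : V f0 -> (forall i, V (F i)) ->
  V (fun x => \sum_(i < n) F i x).
Proof.
move=> Vf0; elim: n F => [|n IH] F VF.
  have := VZ 0 Vf0; congr V; apply/funext => x; by rewrite mul0r big_ord0.
have := VD (IH _ (fun i => VF (widen_ord (leqnSn n) i))) (VF ord_max).
by congr V; apply/funext => x; rewrite big_ord_recr.
Qed.

(** The increment is the integral of f from x to [x + d], a locally uniform limit of Riemann sums,
    and these are combinations of translates of f. *)
Lemma V_antiderivative_increment f F (d : R) : continuous f ->
  (forall x, is_derive x (1 : R) F (f x)) -> V f -> V (fun x => F (x + d) - F x).
Proof.
move=> cf dF Vf; apply: Vcl => M e e0.
(* The N errors add up to at most [|d| * e' <= e]. The modulus of continuity is taken on a segment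
   enlarged by [|d|], which contains all the sample points. *)
pose e' := e / (`|d| + 1).
have d1 : 0 < `|d| + 1 by rewrite ltr_wpDl.
have e'0 : 0 < e' by rewrite divr_gt0.
have [r r0 rf] := segment_unif_continuous (M + `|d|) cf e'0.
pose N := (Num.bound (`|d| / r)).+1.
have N0 : 0 < N%:R :> R by rewrite ltr0n.
pose h := d / N%:R.
have hr : `|h| <= r.
  rewrite /h normrM normfV (gtr0_norm N0) ler_pdivrMr// mulrC -ler_pdivrMr//.
  apply/ltW/(lt_le_trans (archi_boundP _)); first by rewrite divr_ge0// ltW.
  by rewrite ler_nat /N.
exists (fun x => \sum_(i < N) h * f (i%:R * h + 1 * x)).
  by apply: (Vsum (f0 := f)) => // i; apply: VZ; exact: Vaff.
move=> x xM.
have -> : F (x + d) - F x = \sum_(i < N) (F (x + i%:R * h + h) - F (x + i%:R * h)).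
  have {1}-> : d = N%:R * h by rewrite /h mulrC divfK// gt_eqF.
  elim: (N) => [|n IH]; first by rewrite big_ord0 mul0r addr0 subrr.
  rewrite big_ord_recr /= -IH -natr1 mulrDl mul1r addrA.
  by rewrite [RHS]addrC addrA subrK.
rewrite -sumrB; apply: (le_trans (ler_norm_sum _ _ _)).
apply: (@le_trans _ _ (\sum_(i < N) `|h| * e')); last first.
  rewrite sumr_const card_ord -mulr_natl mulrA.
  have -> : N%:R * `|h| = `|d|.
    by rewrite -{1}(gtr0_norm N0) -normrM /h mulrC divfK// gt_eqF.
  by rewrite /e' mulrCA ler_piMr ?ltW// ltr_pdivrMr// mul1r ltrDl.
apply: ler_sum => i _.
have [z zx ->] := @increment_eq R F f (x + i%:R * h) h (fun y _ => dF y).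
rewrite mul1r (addrC _ x) -mulrBr normrM ler_wpM2l// distrC; apply: rf; last first.
  by rewrite distrC; apply: le_trans hr.
apply: le_trans (ler_normD _ _) _; apply: lerD => //.
rewrite normrM ger0_norm// /h normrM normfV (gtr0_norm N0) mulrCA ler_piMr//.
by rewrite ler_pdivrMr// mul1r ler_nat ltnW.
Qed.

Lemma mdiff_derivative s F f :
  (forall x, is_derive x (1 : R) F (f x)) ->
  forall x, is_derive x (1 : R)
    (mdiff s (F : R^o -> R^o) : R -> R) (mdiff s (f : R^o -> R^o) x).
Proof.
move=> dF; elim: s => // k s IH x.
rewrite /mdiff /=; apply: is_deriveB => //.
have dk : is_derive x (1 : R) (fun y : R => y + k) 1.
  by rewrite -[X in is_derive _ _ _ X]addr0; apply: is_deriveD.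
have := @is_derive1_comp R (mdiff s (F : R^o -> R^o)) (fun y => y + k) x _ _ (IH (x + k)) dk.
by rewrite mulr1.
Qed.

(** The mean value theorem applied k times: each use turns one difference into a derivative and
    moves the point by at most [|h|]. *)
Lemma derivatives_mdiff k (g : nat -> R -> R) (h x : R) :
  (forall i y, (i < k)%N -> is_derive y (1 : R) (g i) (g i.+1 y)) ->
  exists2 z, `|z - x| <= k%:R * `|h| &
    mdiff (nseq k h) (g 0 : R^o -> R^o) x = h ^+ k * g k z.
Proof.
elim: k g x => [|k IH] g x dg.
  by exists x; rewrite ?subrr ?normr0 ?mul0r// expr0 mul1r.
have [y yx yE] := @increment_eq R (mdiff (nseq k h) (g 0 : R^o -> R^o)) _ x h
  (fun y _ => @mdiff_derivative _ _ (g 1) (fun y => dg 0 y isT) y).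
have [|z zy zE] := IH (fun i => g i.+1) y.
  by move=> i t ik; apply: dg.
exists z.
  rewrite -(subrK y z) -addrA; apply: le_trans (ler_normD _ _) _.
  by rewrite -natr1 mulrDl mul1r lerD.
by rewrite [mdiff _ _ _]yE zE exprS mulrA.
Qed.

(* If F is an n-fold antiderivative of f, its n-th difference g of step h is in V
   and has n-th derivative the n-th difference of f; the n-th differences of step
   d of s |-> g (x + s t), divided by d^n, then tend to t^n g^(n)(x). *)
Lemma monomial_mem f n (x h : R) : continuous f -> V f ->
  fdiff n (f : R^o -> R^o) x h != 0 -> V (fun t => t ^+ n).
Proof.
move=> cf Vf fn0.
(* A total antiderivative operator; on a discontinuous F it returns F as a default value. *)
have /choice[anti antiE] : forall F, exists G, continuous F ->
    forall x, is_derive x (1 : R) G (F x).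
  move=> F; have [/exists_antiderivative[G dG]|nF] := pselect (continuous F).
    by exists G.
  by exists F.
pose P j := iter j anti f.
have cont_deriv F G : (forall x, is_derive x (1 : R) G (F x)) -> continuous G.
  by move=> dG y; apply/differentiable_continuous/derivable1_diffP; case: (dG y).
have cP j : continuous (P j).
  elim: j => // j IH; apply: cont_deriv; exact: antiE.
have dP j : forall x, is_derive x (1 : R) (P j.+1) (P j x) by apply: antiE; exact: cP.
have cm s F : continuous F -> continuous (mdiff s (F : R^o -> R^o) : R -> R).
  move=> cF; elim: s => // k s IH y.
  apply: (@cvgB R R^o); last exact: IH.
  apply: (@continuous_comp R R R (fun y => y + k)); last exact: IH.
  by apply: cvgD => //; exact: cvg_cst.
have VP j : V (mdiff (nseq j h) (P j : R^o -> R^o)).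
  elim: j => // j IH.
  apply: (@V_antiderivative_increment _ (mdiff (nseq j h) (P j.+1 : R^o -> R^o))
    h (cm (nseq j h) _ (cP j))) => //.
  by apply: mdiff_derivative; exact: dP.
(* [g 0] is the n-th difference of the n-fold antiderivative of f, [g i] its i-th derivative, and
   [g n] the n-th difference of f. *)
pose g i : R -> R := mdiff (nseq n h) (P (n - i)%N : R^o -> R^o).
have dg i y : (i < n)%N -> is_derive y (1 : R) (g i) (g i.+1 y).
  move=> ltin; rewrite /g; apply: mdiff_derivative => z.
  by rewrite -(subnSK ltin); exact: dP.
have Vg : V (g 0) by rewrite /g subn0; exact: VP.
pose A := g n x.
have A0 : A != 0.
  by move: fn0; rewrite /A /g subnn mdiff_nseqE scaler_eq0 signr_eq0.
have gcont : continuous (g n) by apply: cm; exact: cP.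
apply: Vcl => M e e0.
(* Chosen so that the final error, at most [|M| ^+ n * e' / |A|], is below e. *)
pose e' := e * `|A| / (`|M| ^+ n + 1).
have M1 : 0 < `|M| ^+ n + 1 by rewrite ltr_wpDl// exprn_ge0.
have e'0 : 0 < e' by rewrite divr_gt0// mulr_gt0// normr_gt0.
have /cvgrPdist_le /(_ _ e'0) [r /= r0 rg] := gcont x.
have nM1 : 0 < n%:R * `|M| + 1 by rewrite ltr_wpDl// mulr_ge0.
(* Keeps the mean value point, at distance at most [n * d * |t|] from x, within the radius r where
   [g n] varies by at most e'. *)
pose d := r / (n%:R * `|M| + 1).
have d0 : 0 < d by rewrite divr_gt0.
exists (fun t => (d ^+ n * A)^-1 * mdiff (nseq n (d * t)) (g 0 : R^o -> R^o) x).
  apply: VZ.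
  (* As a function of its step, the difference is a combination of affine substitutions in [g 0]. *)
  have -> : (fun t => mdiff (nseq n (d * t)) (g 0%N : R^o -> R^o) x) =
      (fun t => \sum_(i < n.+1) ((-1) ^+ n * ((-1) ^+ i * 'C(n, i)%:R)) *
        g 0%N (x + (i%:R * d) * t)).
    apply/funext => t; have := @mdiff_nseqE R R^o R^o n (g 0%N) x (d * t).
    move=> /(congr1 (fun z => (-1) ^+ n *: z)).
    rewrite scalerA -expr2 sqrr_sign scale1r => <-.
    rewrite /fdiff scaler_sumr; apply: eq_bigr => i _.
    by rewrite scalerA /GRing.scale /= !mulrA.
  by apply: (Vsum (f0 := g 0)) => // i; apply: VZ; exact: Vaff.
move=> t tM.
have [z zx ->] := derivatives_mdiff (d * t) x dg.
have MM : M <= `|M| by exact: ler_norm.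
have dz : `|g n x - g n z| <= e'.
  apply: rg; rewrite /= distrC; apply: le_lt_trans zx _.
  rewrite normrM (gtr0_norm d0).
  have -> : n%:R * (d * `|t|) = r * (n%:R * `|t| / (n%:R * `|M| + 1)) by rewrite /d; ring.
  rewrite gtr_pMr// ltr_pdivrMr// mul1r.
  by rewrite ltr_pwDr// ler_wpM2l// (le_trans tM).
have -> : t ^+ n - (d ^+ n * A)^-1 * ((d * t) ^+ n * g n z) = t ^+ n * ((g n x - g n z) / A).
  have aux (u v w a : R) : u != 0 -> a != 0 ->
      v - (u * a)^-1 * (u * v * w) = v * ((a - w) / a).
    by move=> u0 a0; field; rewrite u0 a0.
  rewrite (exprMn n d t); apply: (aux (d ^+ n) (t ^+ n) (g n z) A _ A0).
  by rewrite expf_neq0 ?gt_eqF.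
rewrite normrM normrX normrM normfV mulrA ler_pdivrMr ?normr_gt0//.
apply: (@le_trans _ _ (`|M| ^+ n * e')).
  apply: ler_pM => //; apply: lerXn2r; rewrite ?nnegrE//; exact: le_trans MM.
rewrite /e' mulrCA ler_piMr//; first by rewrite mulr_ge0// ltW.
by rewrite ler_pdivrMr// mul1r lerDl.
Qed.

End Monomials.

(** * The Stone-Weierstrass theorem *)

(** If P failed for K, the sets U with [P (K \ U)] would form a proper filter; at a cluster point in
    K this contradicts the local hypothesis. *)
Lemma compact_cover_ind (T : topologicalType) (K : set T) (P : set T -> Prop) :
  compact K -> P set0 -> (forall A B, A `<=` B -> P B -> P A) ->
  (forall A B, P A -> P B -> P (A `|` B)) ->
  (forall x, K x -> exists2 U, nbhs x U & P U) -> P K.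
Proof.
move=> cK P0 Pmono PU Ploc; apply: contrapT => nPK.
pose G : set_system T := [set U | P (K `\` U)].
have PG : ProperFilter G.
  split; first by rewrite /G /= setD0.
  split; first by rewrite /G /= setDT.
    by move=> A B GA GB; rewrite /G /= setDIr; exact: PU.
  by move=> A B AB; apply: Pmono; exact: setDS.
have [|x [Kx clx]] := cK G PG; first by rewrite /G /= setDv.
have [U nU PU'] := Ploc x Kx.
have [|y [/= nUy Uy]] := clx (~` U) U _ nU; last by [].
by rewrite /G /=; apply: Pmono PU' => y [_]; rewrite /= notK.
Qed.

Definition compact_approx (R : realType) (T : topologicalType) (W : set (T -> R))
    (K : set T) : set (T -> R) :=
  [set f | forall e, 0 < e -> exists2 g, W g & forall x, K x -> `|f x - g x| <= e].

Section StoneWeierstrass.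
Context {R : realType} {T : topologicalType}.
Implicit Types (f g : T -> R).

Lemma compact_bounded_fun f K : continuous (f : T -> R^o) -> compact K ->
  exists2 M, 0 < M & forall x, K x -> `|f x| <= M.
Proof.
move=> cf cK; apply: (compact_cover_ind
  (P := fun A => exists2 M, 0 < M & forall x, A x -> `|f x| <= M)) => //.
- by exists 1.
- by move=> A B AB [M M0 BM]; exists M => // x /AB /BM.
- move=> A B [M M0 AM] [N N0 BN]; exists (M + N); first exact: addr_gt0.
  by move=> x [/AM|/BN]; lra.
- move=> x _; exists [set y | `|f x - f y| <= 1].
    by have /cvgrPdist_le /(_ 1 ltr01) := cf x.
  exists (`|f x| + 1); first by rewrite ltr_wpDl.
  move=> y /= fxy; rewrite -(subrK (f x) (f y)) addrC; apply: le_trans (ler_normD _ _) _.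
  by rewrite distrC lerD2l.
Qed.

Variable W : set (T -> R).
Hypothesis Wcont : forall f, W f -> continuous (f : T -> R^o).
Hypothesis W1 : W (fun=> 1).
Hypothesis WD : forall f g, W f -> W g -> W (fun x => f x + g x).
Hypothesis WM : forall f g, W f -> W g -> W (fun x => f x * g x).
Hypothesis WZ : forall a f, W f -> W (fun x => a * f x).
Variables (K : set T) (cK : compact K).

Local Notation Y := (compact_approx W K).

Lemma approx_mem f : W f -> Y f.
Proof. by move=> Wf e e0; exists f => // x _; rewrite subrr normr0 ltW. Qed.

Lemma approx_closed f :
  (forall e : R, 0 < e -> exists2 g, Y g & forall x, K x -> `|f x - g x| <= e) -> Y f.
Proof.
move=> h e e0; have e20 : 0 < e / 2 by rewrite divr_gt0.
have [g Yg fg] := h _ e20; have [k Wk gk] := Yg _ e20; exists k => // x Kx.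
rewrite -(subrK (g x) (f x)) -addrA; apply: le_trans (ler_normD _ _) _.
have := fg x Kx; have := gk x Kx; lra.
Qed.

Lemma approxD f g : Y f -> Y g -> Y (fun x => f x + g x).
Proof.
move=> Yf Yg e e0; have e20 : 0 < e / 2 by rewrite divr_gt0.
have [f' Wf ff] := Yf _ e20; have [g' Wg gg] := Yg _ e20.
exists (fun x => f' x + g' x); first exact: WD.
move=> x Kx; rewrite opprD addrACA; apply: le_trans (ler_normD _ _) _.
have := ff x Kx; have := gg x Kx; lra.
Qed.

Lemma approxZ a f : Y f -> Y (fun x => a * f x).
Proof.
move=> Yf e e0; have a1 : 0 < `|a| + 1 by rewrite ltr_wpDl.
have [f' Wf ff] := Yf _ (divr_gt0 e0 a1).
exists (fun x => a * f' x); first exact: WZ.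
move=> x Kx; rewrite -mulrBr normrM.
apply: (@le_trans _ _ ((`|a| + 1) * (e / (`|a| + 1)))).
  by apply: ler_pM => //; [rewrite lerDl|exact: ff].
by rewrite mulrC divfK// gt_eqF.
Qed.

Lemma approx_bounded f : Y f -> exists2 M, 0 < M & forall x, K x -> `|f x| <= M.
Proof.
move=> /(_ 1 ltr01) [g Wg fg]; have [M M0 gM] := compact_bounded_fun (Wcont Wg) cK.
exists (1 + M); first exact: addr_gt0.
move=> x Kx; rewrite -(subrK (g x) (f x)); apply: le_trans (ler_normD _ _) _.
by apply: lerD; [exact: fg|exact: gM].
Qed.

Lemma approxM f g : Y f -> Y g -> Y (fun x => f x * g x).
Proof.
move=> Yf Yg e e0.
have [M M0 fM] := approx_bounded Yf.
(* The approximant g' is chosen first: its bound N then fixes the tolerance for f'. *)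
have e10 : 0 < e / 2 / M by rewrite !divr_gt0.
have [g' Wg gg] := Yg _ e10.
have [N N0 gN] := compact_bounded_fun (Wcont Wg) cK.
have e20 : 0 < e / 2 / N by rewrite !divr_gt0.
have [f' Wf ff] := Yf _ e20.
exists (fun x => f' x * g' x); first exact: WM.
move=> x Kx.
have -> : f x * g x - f' x * g' x = f x * (g x - g' x) + (f x - f' x) * g' x by ring.
apply: le_trans (ler_normD _ _) _; rewrite !normrM.
have h1 : `|f x| * `|g x - g' x| <= M * (e / 2 / M).
  by apply: ler_pM => //; [exact: fM|exact: gg].
have h2 : `|f x - f' x| * `|g' x| <= (e / 2 / N) * N.
  by apply: ler_pM => //; [exact: ff|exact: gN].
rewrite (mulrC M) divfK ?gt_eqF// in h1; rewrite divfK ?gt_eqF// in h2.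
lra.
Qed.

(* The error e_n = |x| - u_n satisfies e_(n+1) = e_n (1 - (|x| + u_n) / 2). *)
Lemma sqrt_iteration (x : R) n : `|x| <= 1 ->
  let u := iter n (fun u => u + (x ^+ 2 - u ^+ 2) / 2) 0 in
  0 <= u <= `|x| /\ (`|x| - u) * (1 + n%:R * (`|x| / 2)) <= `|x|.
Proof.
rewrite -real_normK ?num_real//; move: (normr_ge0 x); move: `|x| => y y0 y1.
elim: n => [|n] /=; first by rewrite lexx y0 mul0r addr0 mulr1 subr0.
move: (iter n _ 0) => u [/andP[u0 uy] h].
have e' : y - (u + (y ^+ 2 - u ^+ 2) / 2) = (y - u) * (1 - (y + u) / 2) by field.
split; first by rewrite -[_ <= y]subr_ge0 e'; nra.
rewrite e' -[n.+1%:R]natr1.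
move: (ler0n R n); move: n%:R h => r h r0.
apply: (@le_trans _ _ ((y - u) * ((1 - y / 2) * (1 + (r + 1) * (y / 2))))).
  rewrite -mulrA; apply: ler_wpM2l; first by rewrite subr_ge0.
  apply: ler_wpM2r; last by lra.
  by rewrite addr_ge0// mulr_ge0// ?addr_ge0// divr_ge0.
apply: le_trans h; apply: ler_wpM2l; first by rewrite subr_ge0.
nra.
Qed.

(** After scaling to [|g| <= 1], the iterates of [sqrt_iteration] are polynomials in g and approach
    [|g|] with error below [2 / n], uniformly on K. *)
Lemma approx_norm f : Y f -> Y (fun x => `|f x|).
Proof.
move=> Yf; have [M M0 fM] := approx_bounded Yf.
pose g x := M^-1 * f x.
have Yg : Y g by exact: approxZ.
have g1 x : K x -> `|g x| <= 1.
  move=> Kx; rewrite /g normrM normfV (gtr0_norm M0) ler_pdivrMl// mulr1.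
  exact: fM.
pose u n x := iter n (fun u => u + (g x ^+ 2 - u ^+ 2) / 2) 0.
have Yu n : Y (u n).
  elim: n => [|n IH].
    have := approxZ 0 (approx_mem W1).
    by congr Y; apply/funext => x; rewrite mul0r.
  have := approxD IH (approxZ 2^-1 (approxD (approxM Yg Yg) (approxZ (-1) (approxM IH IH)))).
  by congr Y; apply/funext => x; rewrite /u /= mulN1r mulrC !expr2.
suff Yng : Y (fun x => `|g x|).
  have := approxZ M Yng; congr Y; apply/funext => x.
  by rewrite /g normrM normfV (gtr0_norm M0) mulVKf// gt_eqF.
apply: approx_closed => e e0; pose n := (Num.bound (2 / e)).+1; exists (u n); first exact: Yu.
move=> x Kx; have [/andP[u0 ug] h] := sqrt_iteration n (g1 x Kx).
have {}h : (`|g x| - u n x) * (1 + n%:R * (`|g x| / 2)) <= `|g x| := h.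
rewrite ger0_norm ?subr_ge0//.
have ne : 2 <= n%:R * e.
  rewrite -ler_pdivrMr//; apply/ltW/(lt_le_trans (archi_boundP _)).
    by rewrite divr_ge0// ltW.
  by rewrite ler_nat /n.
rewrite leNgt; apply/negP => eg.
have r0 : 0 <= 1 + n%:R * (`|g x| / 2) by rewrite addr_ge0// mulr_ge0// divr_ge0.
have := ler_wpM2r r0 (ltW eg); have := ler_wpM2r (normr_ge0 (g x)) ne.
move: `|g x| (u n x) (n%:R : R) h => y v r h; lra.
Qed.

Lemma approx_max f g : Y f -> Y g -> Y (fun x => Num.max (f x) (g x)).
Proof.
move=> Yf Yg.
have := approxZ 2^-1 (approxD (approxD Yf Yg) (approx_norm (approxD Yf (approxZ (-1) Yg)))).
by congr Y; apply/funext => x; rewrite maxr_absE mulN1r mulrC.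
Qed.

Lemma approx_min f g : Y f -> Y g -> Y (fun x => Num.min (f x) (g x)).
Proof.
move=> Yf Yg.
have := approxZ (-1) (approx_max (approxZ (-1) Yf) (approxZ (-1) Yg)).
by congr Y; apply/funext => x; rewrite !mulN1r oppr_max !opprK.
Qed.

Hypothesis Wsep : forall x y, x <> y -> exists2 f, W f & f x != f y.

Let interpolate (x y : T) (a b : R) : (x = y -> a = b) ->
  exists2 f, W f & f x = a /\ f y = b.
Proof.
have [<- /(_ erefl) <-|xy _] := pselect (x = y).
  by exists (fun z => a * 1); [exact: WZ|rewrite mulr1].
have [f Wf fxy] := Wsep xy.
have d : f y - f x != 0 by rewrite subr_eq0 eq_sym.
pose c := (b - a) / (f y - f x).
exists (fun z => (a - c * f x) * 1 + c * f z); first by apply: WD; exact: WZ.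
by rewrite /c; split; [ring|field].
Qed.

(** Two passes of compactness. For fixed x, a finite maximum of two-point interpolants lies above
    [f - e] on K and still equals f at x; a finite minimum of such functions also lies below
    [f + e]. *)
Theorem stone_weierstrass f : continuous (f : T -> R^o) -> Y f.
Proof.
move=> cf; apply: approx_closed => e e0.
have [[x0 Kx0]|nK] := pselect (exists x, K x); last first.
  exists (fun=> 1); first exact: approx_mem.
  by move=> x Kx; exfalso; apply: nK; exists x.
have near_lt (g h : T -> R) z : continuous (g : T -> R^o) -> continuous (h : T -> R^o) ->
    g z < h z -> \forall y \near z, g y < h y.
  move=> cg ch gh; have : (fun y => h y - g y : R^o) @ z --> (h z - g z : R^o).
    by apply: cvgB; [exact: ch|exact: cg].
  move=> /cvgrPdist_lt /(_ (h z - g z)); rewrite subr_gt0 => /(_ gh).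
  apply: filterS => y; rewrite ltr_norml; lra.
have below x : exists g, [/\ Y g, continuous (g : T -> R^o), g x = f x &
    forall y, K y -> f y - e < g y].
  apply: (compact_cover_ind (P := fun A => exists g, [/\ Y g,
    continuous (g : T -> R^o), g x = f x & forall y, A y -> f y - e < g y]) cK).
  - have [g Wg [gx _]] := @interpolate x x (f x) (f x) (fun=> erefl).
    by exists g; split=> //; [exact: approx_mem|exact: Wcont].
  - by move=> A B AB [g [Yg cg gx gB]]; exists g; split=> // y /AB /gB.
  - move=> A B [g [Yg cg gx gA]] [h [Yh ch hx hB]].
    exists (fun y => Num.max (g y) (h y)); split.
    + exact: approx_max.
    + by move=> y; apply: continuous_max; [exact: cg|exact: ch].
    + by rewrite gx hx maxxx.
    + by move=> y [/gA|/hB] hy; rewrite lt_max hy ?orbT.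
  - move=> z _; have [|g Wg [gx gz]] := @interpolate x z (f x) (f z); first by move=> ->.
    exists [set y | f y - e < g y].
      apply: (@near_lt (fun y => f y - e) g z) => //; last by rewrite gz; lra.
        by move=> y; apply: cvgB; [exact: cf|exact: cvg_cst].
      exact: Wcont.
    by exists g; split=> //; [exact: approx_mem|exact: Wcont].
have : exists g, [/\ Y g, continuous (g : T -> R^o), forall y, K y -> f y - e < g y &
    forall y, K y -> g y < f y + e].
  apply: (compact_cover_ind (P := fun A => exists g, [/\ Y g,
    continuous (g : T -> R^o), forall y, K y -> f y - e < g y &
    forall y, A y -> g y < f y + e]) cK).
  - by have [g [Yg cg _ gK]] := below x0; exists g; split.
  - by move=> A B AB [g [Yg cg gx gB]]; exists g; split=> // y /AB /gB.
  - move=> A B [g [Yg cg gK gA]] [h [Yh ch hK hB]].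
    exists (fun y => Num.min (g y) (h y)); split.
    + exact: approx_min.
    + by move=> y; apply: continuous_min; [exact: cg|exact: ch].
    + by move=> y Ky; rewrite lt_min gK// hK.
    + by move=> y [/gA|/hB] hy; rewrite gt_min hy ?orbT.
  - move=> z Kz; have [g [Yg cg gz gK]] := below z.
    exists [set y | g y < f y + e].
      apply: (@near_lt g (fun y => f y + e) z) => //; last by rewrite gz; lra.
      by move=> y; apply: cvgD; [exact: cf|exact: cvg_cst].
    by exists g; split.
move=> [g [Yg _ gl gu]]; exists g => // x Kx.
by rewrite ler_norml; have := gl x Kx; have := gu x Kx; lra.
Qed.

End StoneWeierstrass.

(** * Bounded degree by Baire category *)

Section Baire.

(** If no [C i] had an interior point, the complements would be open and dense, and a common point
    of theirs would escape the cover. *)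
Lemma baire_closed_cover (T : topologicalType) (C : nat -> set T) (x0 : T) :
  baire_space T -> (forall i, closed (C i)) -> (forall x, exists i, C i x) ->
  exists i (x : T), nbhs x (C i).
Proof.
move=> bT cC cov; apply: contrapT => nC.
have /bT : forall i, open (~` C i) /\ dense (~` C i).
  move=> i; split; first exact: closed_openC.
  move=> O [x Ox] oO; apply: contrapT => OC; apply: nC; exists i, x.
  apply: (@filterS _ _ _ O); last exact: open_nbhs_nbhs.
  move=> y Oy; apply: contrapT => nCy.
  by apply: OC; exists y.
move=> /(_ setT) []; [by exists x0|exact: openT|].
move=> x [_ /= h]; have [i Cx] := cov x; exact: h Cx.
Qed.

Lemma poly_eq0_near0 (R : realType) (p : {poly R}) :
  (\forall t \near (0 : R^o), p.[t] = 0) -> p = 0.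
Proof.
(* The roots [e / (n + 2)] are distinct and strictly inside the radius e. *)
move=> [e /= e0 pe]; apply: (@poly_eq0_inj _ _ (fun n => e / n.+2%:R)) => [m n|n].
  by move=> /= /(mulfI (lt0r_neq0 e0)) /invr_inj /eqP; rewrite eqr_nat !eqSS => /eqP.
suff : `|0 - e / n.+2%:R| < e by move=> /pe.
rewrite sub0r normrN gtr0_norm ?divr_gt0//.
by rewrite ltr_pdivrMr// ltr_pMr// ltr1n.
Qed.

(* A closed set which is the common zero set of functions that are polynomial
   along lines is the whole space as soon as it has an interior point. *)
Lemma baire_line_poly (R : realType) (T : topologicalType) (Q : nat -> set (T -> R^o))
    (x0 : T) (line : T -> T -> R -> T) :
  baire_space T ->
  (forall x y, line x y 0 = x) -> (forall x y, line x y 1 = y) ->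
  (forall x y, line x y t @[t --> (0 : R^o)] --> x) ->
  (forall i q, Q i q -> continuous q) ->
  (forall i q x y, Q i q -> exists p : {poly R}, forall t, q (line x y t) = p.[t]) ->
  (forall x, exists i, forall q, Q i q -> q x = 0) ->
  exists i, forall q, Q i q -> forall x, q x = 0.
Proof.
move=> bT l0 l1 lc cQ pQ cov.
have [||i [x nx]] := @baire_closed_cover T
    (fun i => \bigcap_(q in Q i) (q @^-1` [set 0])) x0 bT.
- move=> i; apply: closed_bigI => q Qq; apply: preimage_closed => [t _|].
    exact: cQ Qq t.
  exact: closed_eq.
- by move=> x; have [i Qx] := cov x; exists i => q /Qx.
exists i => q Qq y; have [p pE] := pQ i q x y Qq.
rewrite -(l1 x y) pE (_ : p = 0) ?horner0//; apply: poly_eq0_near0.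
have lnx : \forall t \near (0 : R^o), forall q, Q i q -> q (line x y t) = 0.
  exact: lc nx.
by near=> t; rewrite -pE; near: t; apply: filterS lnx => t; apply.
Unshelve. all: by end_near.
Qed.

End Baire.

(** * Affine lines, evaluation of functionals, and the Baire argument for the degree *)

Lemma dual_linearE (R : realType) (F : tvsType R) (a : R) (mu nu : dual F) y :
  (a *: mu + nu) y = a * mu y + nu y.
Proof.
by rewrite -[dual_fun _]/(\val _) GRing.linearP.
Qed.

(** Named so that it can carry the linear structure that [Aff] asks for; [rank_one] below is named
    for the same reason. *)
Definition scalar_line (R : realType) (E : lmodType R) (h : E) (t : R^o) : E := t *: h.

Lemma scalar_line_linear (R : realType) (E : lmodType R) (h : E) : linear (scalar_line h).
Proof. by move=> a u v; rewrite /scalar_line scalerDl scalerA. Qed.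

HB.instance Definition _ (R : realType) (E : lmodType R) (h : E) :=
  GRing.isLinear.Build R R^o E _ (scalar_line h) (scalar_line_linear h).

Lemma continuous_scalel (R : realType) (E : tvsType R) (h : E) :
  continuous (fun t : R^o => t *: h).
Proof.
move=> t; apply: (@continuous_comp R^o (R^o * E)%type E (fun t => (t, h))
  (fun z => z.1 *: z.2)); last exact: scale_continuous.
by apply: (@cvg_pair _ _ _ _ (nbhs (t : R^o))); [exact: cvg_id|exact: cvg_cst].
Qed.

Lemma Aff_line (R : realType) (E : tvsType R) (x h : E) :
  Aff (fun t : R^o => x + t *: h).
Proof.
exists (scalar_line h : {linear R^o -> E}); split; first exact: continuous_scalel.
by exists x => t; rewrite addrC.
Qed.

Lemma Aff_real (R : realType) (E : tvsType R) (f : R^o -> E) : Aff f ->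
  forall t, f t = f 0 + t *: (f 1 - f 0).
Proof.
move=> [T [_ [b fE]]] t; rewrite !fE linear0 add0r addrK -linearZ /=.
by rewrite /GRing.scale /= mulr1 addrC.
Qed.

Lemma weak_star_eval_open (R : realType) (F : tvsType R) (e : F) (O : set R^o) :
  open O -> open ([set nu : weak_star F | O ((nu : dual F) e)]).
Proof.
move=> oO.
have : continuous (fun nu : weak_star F => (nu : dual F) e : R^o).
  move=> nu.
  apply: (@continuous_comp _ {ptws F -> R^o} _
     ((fun nu => nu) : weak_star F -> {ptws F -> R^o}) (fun f => f e)).
    exact: initial_continuous.
  exact: proj_continuous.
by move=> /continuousP /(_ _ oO).
Qed.

Lemma with_topology_eval_continuous (R : realType) (F : tvsType R)
    (tau : topology_on (dual F)) (e : F) : stronger_than_weak_star tau ->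
  continuous (fun nu : with_topology tau => (nu : dual F) e : R^o).
Proof.
move=> st; apply/continuousP => O oO.
exact: st (weak_star_eval_open e oO).
Qed.

Lemma poly_lincomb (R : realType) n (c : 'I_n -> R) (u : 'I_n -> R -> R) :
  (forall i, exists p : {poly R}, forall t, u i t = p.[t]) ->
  exists p : {poly R}, forall t, \sum_(i < n) c i * u i t = p.[t].
Proof.
move=> /choice[p pE]; exists (\sum_(i < n) c i *: p i) => t.
by rewrite horner_sum; apply: eq_bigr => i _; rewrite hornerZ pE.
Qed.

Lemma continuous_lincomb (R : realType) (T : topologicalType) n (c : 'I_n -> R)
    (u : 'I_n -> T -> R^o) : (forall i, continuous (u i)) ->
  continuous (fun x => \sum_(i < n) c i *: u i x : R^o).
Proof.
elim: n c u => [|n IH] c u cu x.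
  under eq_fun do rewrite big_ord0; exact: cvg_cst.
under eq_fun do rewrite big_ord_recr.
apply: cvgD; first exact: (IH (fun i => c (widen_ord (leqnSn n) i))
  (fun i => u (widen_ord (leqnSn n) i))).
by apply: cvgZr; exact: cu.
Qed.

Lemma continuous_lineB (R : realType) (E : tvsType R) (x y : E) :
  (x + t *: (y - x)) @[t --> (0 : R^o)] --> x.
Proof.
rewrite -[X in _ --> X]addr0 -(scale0r (y - x)).
apply: (@continuous_comp R^o (E * E)%type E (fun t => (x, t *: (y - x)))
  (fun z => z.1 + z.2)); last exact: add_continuous.
by apply: cvg_pair; [exact: cvg_cst|exact: continuous_scalel].
Qed.

Section Degree.
Context {R : realType} {E F : tvsType R}.
Variables (Phi : E -> F) (contPhi : continuous Phi).

Let Delta n (nu : dual F) x h : R^o := fdiff n ((nu : F -> R^o) \o Phi) x h.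

Lemma continuous_translate (a : E) (b : R) : continuous (fun x : E => a + b *: x).
Proof.
move=> x; apply: (@continuous_comp E (E * E)%type E (fun x => (a, b *: x))
  (fun z => z.1 + z.2)); last exact: add_continuous.
apply: cvg_pair; first exact: cvg_cst.
apply: (@continuous_comp E (R^o * E)%type E (fun x => (b : R^o, x))
  (fun z => z.1 *: z.2)); last exact: scale_continuous.
by apply: (@cvg_pair _ _ _ _ (nbhs (b : R^o))); [exact: cvg_cst|exact: cvg_id].
Qed.

Let cont_nuPhi (nu : dual F) : continuous ((nu : F -> R^o) \o Phi).
Proof.
by move=> x; apply: continuous_comp; [exact: contPhi|exact: dual_continuous].
Qed.

Lemma baire_bounded_degree (tau : topology_on (dual F)) :
  baire_space E ->
  vector_topology tau -> stronger_than_weak_star tau -> baire_space (with_topology tau) ->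
  (forall (nu : dual F) (x h : E),
     exists p : {poly R}, forall t, nu (Phi (x + t *: h)) = p.[t]) ->
  exists n, forall nu x h, Delta n nu x h = 0.
Proof.
move=> bE [tadd tscale] tweak bF pP.
(* A polynomial of size s is killed by differences of order s; so far the order depends on nu, x and
   h. *)
have pointwise nu x h : exists n, Delta n nu x h = 0.
  have [p pE] := pP nu x h; exists (size p).
  apply: (@fdiff_line0 _ _ _ (size p) (size p) (fun i => p`_i)) => // t.
  by rewrite /= pE horner_coef; apply: eq_bigr => i _; rewrite mulrC.
(* First use of Baire, in the base point x, with nu and h fixed. *)
have base_free (nu : dual F) h : exists n, forall x, Delta n nu x h = 0.
  have [||||||n nP] := @baire_line_poly R E
    (fun n => [set q | q = (fun x => Delta n nu x h)]) 0
    (fun x y t => x + t *: (y - x)) bE.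
  - by move=> x y; rewrite scale0r addr0.
  - by move=> x y; rewrite scale1r addrC subrK.
  - exact: continuous_lineB.
  - move=> n _ -> ; apply: continuous_lincomb => i x.
    apply: (@continuous_comp E E R^o (fun x => x + i%:R *: h)); last exact: cont_nuPhi.
    have -> : (fun x => x + i%:R *: h) = (fun x => i%:R *: h + 1 *: x).
      by apply/funext => z; rewrite scale1r addrC.
    exact: continuous_translate.
  - move=> n _ x y ->; apply: poly_lincomb => i.
    have [p pE] := pP nu (x + i%:R *: h) (y - x); exists p => t.
    by rewrite -pE /= addrAC.
  - by move=> x; have [n nx] := pointwise nu x h; exists n => _ ->.
  - by exists n; exact: nP.
(* Second use, in the step h: the conditions of order n now range over all x. As h moves along a
   line, so does each point [x + i h]. *)
have step_free (nu : dual F) : exists n, forall x h, Delta n nu x h = 0.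
  have [||||||n nP] := @baire_line_poly R E
    (fun n => [set q | exists x, q = (fun h => Delta n nu x h)]) 0
    (fun x y t => x + t *: (y - x)) bE.
  - by move=> x y; rewrite scale0r addr0.
  - by move=> x y; rewrite scale1r addrC subrK.
  - exact: continuous_lineB.
  - move=> n _ [x ->] ; apply: continuous_lincomb => i h.
    apply: (@continuous_comp E E R^o (fun h => x + i%:R *: h)); last exact: cont_nuPhi.
    exact: continuous_translate.
  - move=> n _ h k [x ->]; apply: poly_lincomb => i.
    have [p pE] := pP nu (x + i%:R *: h) (i%:R *: (k - h)); exists p => t.
    by rewrite -pE /= -addrA scalerDr !scalerA mulrC.
  - by move=> h; have [n nx] := base_free nu h; exists n => _ [x ->].
  - by exists n => x; apply: nP; exists x.
(* Third use, in nu: evaluations are continuous because tau is stronger than weak*, and along lines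
   of functionals they are polynomials of degree at most 1. *)
have [||||||n nP] := @baire_line_poly R (with_topology tau)
  (fun n => [set q | exists x h, q = (fun nu : with_topology tau => Delta n nu x h)])
  (0 : dual F) (fun mu nu t => mu + t *: (nu - mu)) bF.
- by move=> x y; rewrite scale0r addr0.
- by move=> x y; rewrite scale1r addrC subrK.
- move=> mu nu; rewrite -[X in _ --> X]addr0 -(scale0r (nu - mu)).
  apply: (@continuous_comp R^o (with_topology tau * with_topology tau)%type
    (with_topology tau) (fun t => (mu, t *: (nu - mu))) (fun z => z.1 + z.2)); last exact: tadd.
  apply: (@cvg_pair R^o (with_topology tau) (with_topology tau) (nbhs (0 : R^o))
    (nbhs (mu : with_topology tau)) (nbhs (0 *: (nu - mu) : with_topology tau))).
    exact: cvg_cst.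
  apply: (@continuous_comp R^o (R^o * with_topology tau)%type (with_topology tau)
    (fun t => (t, nu - mu)) (fun z => z.1 *: z.2)); last exact: tscale.
  apply: (@cvg_pair R^o R^o (with_topology tau) (nbhs (0 : R^o)) (nbhs (0 : R^o))
    (nbhs (nu - mu : with_topology tau))); [exact: cvg_id|exact: cvg_cst].
- move=> n _ [x [h ->]]; apply: continuous_lincomb => i.
  exact: with_topology_eval_continuous.
- move=> n _ mu nu [x [h ->]]; apply: poly_lincomb => i.
  pose y := Phi (x + i%:R *: h).
  exists ((mu y)%:P + ((nu - mu : dual F) y)%:P * 'X) => t.
  rewrite !hornerE /=.
  have := dual_linearE t (nu - mu : dual F) (mu : dual F) y.
  by rewrite addrC mulrC [mu y + _]addrC.
- by move=> nu; have [n nx] := step_free nu; exists n => _ [x [h ->]].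
- exists n => nu x h; apply: (nP (fun nu : with_topology tau => Delta n nu x h)).
  by exists x, h.
Qed.

End Degree.

(** * Density in the compact-open topology *)

Section ContFun.
Context {R : realType} {E : tvsType R}.

Definition cont_fun_of (f : E -> R^o) (cf : continuous f) : cont_fun E :=
  (mkcts cf : continuousType E R^o).

(** The sets B generate a filter that converges to f uniformly on compact sets. As f is continuous,
    it also converges in the compact-open topology, so some B lies in the given open set. *)
Lemma cont_fun_cvg_compact (f : cont_fun E) (O : set (cont_fun E)) : open O -> O f ->
  exists K e, [/\ compact K, 0 < e & forall g : cont_fun E,
    (forall x, K x -> `|(f : continuousType E R^o) x - (g : continuousType E R^o) x| <= e) ->
    O g].
Proof.
move=> [/= U oU <-] Uf.
pose B (i : set E * R) : set (E -> R^o) :=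
  [set g | forall x, i.1 x -> `|(f : continuousType E R^o) x - g x| <= i.2].
pose G := filter_from [set i : set E * R | compact i.1 /\ 0 < i.2] B.
have FG : Filter G.
  apply: filter_from_filter; first by exists (set0, 1); split => //; exact: compact0.
  move=> [K1 e1] [K2 e2] [/= c1 p1] [/= c2 p2].
  exists (K1 `|` K2, Num.min e1 e2).
    by split => /=; [exact: compactU|rewrite lt_min p1].
  move=> g Bg; split=> x /= Kx.
    by have := Bg x (or_introl Kx); rewrite /= le_min => /andP[].
  by have := Bg x (or_intror Kx); rewrite /= le_min => /andP[].
have cf : continuous ((f : continuousType E R^o) : E -> R^o) by exact: cts_fun.
have : {family compact, G --> ((f : continuousType E R^o) : E -> R^o)}.
  apply/fam_cvgP => K cK P /uniform_nbhs [A [entA AP]].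
  have /= := entA; rewrite -entourage_from_ballE => -[e /= e0 eA].
  exists (K, e / 2); first by split => //=; rewrite divr_gt0.
  move=> g /= Bg; apply: AP => y Ky; apply: eA => /=.
  apply: le_lt_trans (Bg y Ky) _ => /=.
  by rewrite ltr_pdivrMr// ltr_pMr// ltr1n.
move=> /((compact_open_fam_compactP cf FG).2).
have nU : nbhs ((f : continuousType E R^o) : {compact-open, E -> R^o}) U.
  exact: open_nbhs_nbhs.
move=> /(_ _ nU) [[K e] [/= cK e0] BU]; exists K, e; split=> // g gK.
exact: BU.
Qed.

Lemma cont_fun_eval (x : E) :
  continuous (fun f : cont_fun E => (f : continuousType E R^o) x : R^o).
Proof.
have ce : continuous (fun f : {compact-open, E -> R^o} => f x : R^o).
  apply/continuousP => O oO.
  have -> : (fun f : {compact-open, E -> R^o} => f x) @^-1` O =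
      [set g : {compact-open, E -> R^o} | g @` [set x] `<=` O].
    by apply/seteqP; split=> g /=; [move=> Og _ [_ -> <-]|apply; exists x].
  by apply: compact_open_open => //; exact: compact_set1.
move=> f; apply: (@continuous_comp _ {compact-open, E -> R^o} _
  ((fun f : continuousType E R^o => f : E -> R^o) : cont_fun E -> {compact-open, E -> R^o})
  (fun f => f x)); last exact: ce.
exact: initial_continuous.
Qed.

End ContFun.

Lemma dual0E (R : realType) (E : tvsType R) (y : E) : (0 : dual E) y = 0.
Proof.
by have := dual_linearE (-1) (0 : dual E) 0 y; rewrite scaleN1r addNr mulN1r addNr.
Qed.

Section LinearSpan.
Context {R : realType} {V : lmodType R}.
Variable A : set V.

Lemma linear_span_sub v : A v -> linear_span A v.
Proof.
by move=> Av; exists 1%N, (fun=> 1), (fun=> v); split=> //; rewrite big_ord1 scale1r.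
Qed.

Lemma linear_spanZ a v : linear_span A v -> linear_span A (a *: v).
Proof.
move=> [n [c [u [Au ->]]]]; exists n, (fun i => a * c i), u; split=> //.
by rewrite scaler_sumr; apply: eq_bigr => i _; rewrite scalerA.
Qed.

Lemma linear_spanD v w : linear_span A v -> linear_span A w -> linear_span A (v + w).
Proof.
move=> [n [c [u [Au ->]]]] [m [d [t [At ->]]]].
exists (n + m)%N, (fun i => match fintype.split i with inl j => c j | inr j => d j end),
  (fun i => match fintype.split i with inl j => u j | inr j => t j end); split.
  by move=> i; case: (fintype.split i).
rewrite big_split_ord /=; congr (_ + _); apply: eq_bigr => i _.
  by rewrite (unsplitK (inl i)).
by rewrite (unsplitK (inr i)).
Qed.

End LinearSpan.

Lemma fct_lincombE (R : realType) (T : Type) n (c : 'I_n -> R) (a : 'I_n -> T -> R^o) x :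
  (\sum_(i < n) c i *: a i) x = \sum_(i < n) c i *: a i x.
Proof. by rewrite fct_sumE. Qed.

Lemma linear_span_continuous (R : realType) (E : tvsType R) (A : set (E -> R^o)) f :
  (forall g, A g -> continuous g) -> linear_span A f -> continuous f.
Proof.
move=> cA [n [c [a [Aa ->]]]].
have -> : \sum_(i < n) c i *: a i = (fun x => \sum_(i < n) c i *: a i x).
  by apply/funext => x; exact: fct_lincombE.
by apply: continuous_lincomb => i; exact: cA.
Qed.

Definition rank_one (R : realType) (E G : tvsType R) (lam : dual E) (k : G) (e : E) : G :=
  lam e *: k.

Lemma rank_one_linear (R : realType) (E G : tvsType R) (lam : dual E) (k : G) :
  linear (rank_one lam k).
Proof.
by move=> a u v; rewrite /rank_one (@dual_linear _ _ lam) scalerDl scalerA.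
Qed.

HB.instance Definition _ (R : realType) (E G : tvsType R) (lam : dual E) (k : G) :=
  GRing.isLinear.Build R E G _ (rank_one lam k) (rank_one_linear lam k).

(** Turns an affine line into an affine map on E. With G = E, this brings functions of one variable,
    composed with a functional, into the orbit. *)
Lemma Aff_comp_dual (R : realType) (E G : tvsType R) (lam : dual E) (c : R) (h : R^o -> G) :
  Aff h -> Aff (fun e => h (c + lam e)).
Proof.
move=> /Aff_real hE.
exists (rank_one lam (h 1 - h 0) : {linear E -> G}); split.
  move=> x; apply: (@continuous_comp E R^o G lam (fun t => t *: (h 1 - h 0))).
    exact: dual_continuous.
  exact: continuous_scalel.
exists (h 0 + c *: (h 1 - h 0)) => e.
by rewrite hE scalerDl /= /rank_one addrA addrC.
Qed.

Section Density.
Context {R : realType} {E F : tvsType R}.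
Hypothesis hausE : hausdorff_space E.
Variables (Phi : E -> F) (contPhi : continuous Phi).

Definition affine_orbit : set (E -> R^o) :=
  [set psi | exists (nu : dual F) (g : E -> E), Aff g /\ psi = nu \o Phi \o g].

Lemma Aff_continuous (E1 E2 : tvsType R) (g : E1 -> E2) : Aff g -> continuous g.
Proof.
move=> [T [cT [b gE]]] x.
rewrite (_ : g = fun e => T e + b); last by apply/funext.
apply: (@continuous_comp E1 (E2 * E2)%type E2 (fun e => (T e, b)) (fun z => z.1 + z.2)).
  by apply: cvg_pair; [exact: cT|exact: cvg_cst].
exact: add_continuous.
Qed.

Lemma affine_orbit_continuous psi : affine_orbit psi -> continuous psi.
Proof.
move=> [nu [g [/Aff_continuous cg ->]]] x.
apply: continuous_comp; first exact: cg.
by apply: continuous_comp; [exact: contPhi|exact: dual_continuous].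
Qed.

(** The closure of the span under uniform convergence on compact sets. *)
Let X : set (E -> R) :=
  [set f | forall K, compact K -> compact_approx (linear_span affine_orbit) K f].

Let XD f g : X f -> X g -> X (fun x => f x + g x).
Proof.
by move=> Xf Xg K cK; apply: approxD (Xf K cK) (Xg K cK) => *; exact: linear_spanD.
Qed.

Let XZ a f : X f -> X (fun x => a * f x).
Proof. by move=> Xf K cK; apply: approxZ (Xf K cK) => *; exact: linear_spanZ. Qed.

(* Spanned by exponentials rather than by all polynomials in functionals: it is
   visibly stable under products. *)
Inductive exp_span : (E -> R) -> Prop :=
| exp_span_exp (lam : dual E) : exp_span (fun e => expR (lam e))
| exp_spanD f g : exp_span f -> exp_span g -> exp_span (fun e => f e + g e)
| exp_spanZ a f : exp_span f -> exp_span (fun e => a * f e).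

Lemma exp_span_continuous f : exp_span f -> continuous (f : E -> R^o).
Proof.
elim=> [lam|{}f g _ cf _ cg|a {}f _ cf] x.
- apply: (@continuous_comp E R^o R^o lam expR); first exact: dual_continuous.
  exact: continuous_expR.
- by apply: cvgD; [exact: cf|exact: cg].
- by apply: cvgMr; exact: cf.
Qed.

Lemma exp_span1 : exp_span (fun=> 1).
Proof.
have := exp_span_exp 0; congr exp_span; apply/funext => e.
by rewrite dual0E expR0.
Qed.

Lemma exp_spanM f g : exp_span f -> exp_span g -> exp_span (fun e => f e * g e).
Proof.
move=> ef; elim: ef g => [lam|{}f f' _ IH _ IH'|a {}f _ IH] g eg.
- elim: eg => [mu|{}g g' _ IH _ IH'|a {}g _ IH].
  + have := exp_span_exp (1 *: lam + mu); congr exp_span; apply/funext => e.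
    by rewrite dual_linearE mul1r expRD.
  + by have := exp_spanD IH IH'; congr exp_span; apply/funext => e; rewrite mulrDr.
  + by have := exp_spanZ a IH; congr exp_span; apply/funext => e; rewrite mulrCA.
- by have := exp_spanD (IH _ eg) (IH' _ eg); congr exp_span; apply/funext => e; rewrite mulrDl.
- by have := exp_spanZ a (IH _ eg); congr exp_span; apply/funext => e; rewrite mulrA.
Qed.

Lemma exp_span_separates x y : x <> y -> exists2 f, exp_span f & f x != f y.
Proof.
move=> xy; have [lam lxy] : exists lam : dual E, lam (x - y) != 0.
  apply: contrapT => h; apply: xy; apply/eqP; rewrite -subr_eq0; apply/eqP.
  apply: (dual_separates hausE) => lam; apply: contrapT => /eqP l0.
  by apply: h; exists lam.
exists (fun e => expR (lam e)); first exact: exp_span_exp.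
apply: contra lxy => /eqP /expR_inj e.
by rewrite (linear_sub (@dual_linear _ _ lam)) e subrr.
Qed.

Lemma dense_affine_orbit :
  (forall n, exists (nu : dual F) (h : R^o -> E) (x d : R),
     Aff h /\ fdiff n.+1 (nu \o Phi \o h) x d != 0) ->
  forall K f, compact K -> continuous (f : E -> R^o) ->
  compact_approx (linear_span affine_orbit) K f.
Proof.
move=> unbounded.
(* The functions of one variable whose compositions with all affine functionals lie in X; V has the
   closure properties required by [monomial_mem]. *)
pose V : set (R -> R) := [set phi | forall (lam : dual E) c, X (fun e => phi (c + lam e))].
have VD f g : V f -> V g -> V (fun x => f x + g x).
  by move=> Vf Vg lam c; apply: XD; [exact: Vf|exact: Vg].
have VZ a f : V f -> V (fun x => a * f x) by move=> Vf lam c; apply: XZ; exact: Vf.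
have Vaff s c f : V f -> V (fun x => f (c + s * x)).
  (* The dilation is absorbed into the functional and the translation into the constant; the zero
     functional is added to match [dual_linearE]. *)
  move=> Vf lam c'; have := Vf (s *: lam + 0) (c + s * c').
  by congr X; apply/funext => e; rewrite dual_linearE dual0E addr0 mulrDr addrA.
have Vcl f : (forall M e : R, 0 < e ->
    exists2 g, V g & forall x, `|x| <= M -> `|f x - g x| <= e) -> V f.
  move=> h lam c K cK; apply: approx_closed => e e0.
  have [M M0 lM] := compact_bounded_fun (@dual_continuous _ _ lam) cK.
  have [g Vg fg] := h (`|c| + M) e e0.
  exists (fun x => g (c + lam x)); first exact: Vg.
  by move=> x Kx; apply: fg; apply: le_trans (ler_normD _ _) _; rewrite lerD2l lM.
have Vpow n : V (fun t => t ^+ n.+1).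
  have [nu [h [x [d [hA fd]]]]] := unbounded n.
  have cf : continuous (nu \o Phi \o h : R^o -> R^o).
    move=> t; apply: continuous_comp; first exact: Aff_continuous hA _.
    by apply: continuous_comp; [exact: contPhi|exact: dual_continuous].
  apply: (monomial_mem VD VZ Vaff Vcl cf _ fd) => lam c K cK.
  apply: approx_mem; apply: linear_span_sub.
  by exists nu, (fun e => h (c + lam e)); split=> //; exact: Aff_comp_dual.
(* Nonzero differences give positive powers only; the constant is [(1 + t) - t]. *)
have V1 : V (fun=> 1).
  have := VD _ _ (Vaff 1 1 _ (Vpow 0%N)) (VZ (-1) _ (Vpow 0%N)).
  by congr V; apply/funext => t; rewrite !expr1 mul1r mulN1r addrK.
have Vpoly (p : {poly R}) : V (fun t => p.[t]).
  have Vn n : V (fun t => t ^+ n).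
    by case: n => [|n]; [under eq_fun do rewrite expr0|exact: Vpow].
  have : V (fun t => \sum_(i < size p) p`_i * t ^+ i).
    elim: (size p) => [|n IH].
      by have := VZ 0 _ V1; congr V; apply/funext => t; rewrite mul0r big_ord0.
    have := VD _ _ IH (VZ p`_n _ (Vn n)).
    by congr V; apply/funext => t; rewrite big_ord_recr.
  by congr V; apply/funext => t; rewrite horner_coef.
(* Polynomial approximation of exp on [[-M, M]], by Stone-Weierstrass on the line. *)
have Vexp : V expR.
  apply: Vcl => M e e0.
  have cM := @segment_compact R (- M) M.
  have := @stone_weierstrass R R^o [set f | exists p : {poly R}, f = (fun t => p.[t])]
    _ _ _ _ _ _ cM _ expR (@continuous_expR R) e e0.
  case.
  - by move=> _ [p ->]; exact: continuous_horner.
  - by exists 1; apply/funext => t; rewrite hornerC.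
  - by move=> _ _ [p ->] [q ->]; exists (p + q); apply/funext => t; rewrite hornerD.
  - by move=> _ _ [p ->] [q ->]; exists (p * q); apply/funext => t; rewrite hornerM.
  - by move=> a _ [p ->]; exists (a *: p); apply/funext => t; rewrite hornerZ.
  - move=> x y /eqP xy; exists (fun t => 'X.[t]); first by exists 'X.
    by rewrite !hornerX.
  move=> _ [p ->] pE; exists (fun t => p.[t]); first exact: Vpoly.
  by move=> x xM; apply: pE; rewrite /= in_itv /= -ler_norml.
have expX f : exp_span f -> X f.
  elim=> [lam|{}f g _ Xf _ Xg|a {}f _ Xf]; [|exact: XD|exact: XZ].
  have := Vexp lam 0; congr X; apply/funext => e; by rewrite add0r.
move=> K f cK cf; apply: approx_closed => e e0.
have [g eg fg] := stone_weierstrass exp_span_continuous exp_span1 exp_spanD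
  exp_spanM exp_spanZ cK exp_span_separates cf e0.
by exists g => //; exact: expX.
Qed.

End Density.

(** * Equivalence of the conditions *)

Lemma linear_fdiff (R : realType) (V W : lmodType R) (nu : W -> R^o) (f : V -> W) n x h :
  linear nu -> nu (fdiff n f x h) = fdiff n (nu \o f : V -> R^o) x h.
Proof.
move=> lnu; rewrite /fdiff; elim/big_rec2: _ => [|i y z _ <-].
  exact: linear_zero.
by rewrite lnu.
Qed.

(** Passes from the order n found by the Baire argument to the order [n + 1] in
    [fdiff_dual_polynomial]. *)
Lemma fdiffS_eq0 (R : realType) (V W : lmodType R) (f : V -> W) n x h :
  (forall x, fdiff n f x h = 0) -> fdiff n.+1 f x h = 0.
Proof.
move=> f0; have m0 y : mdiff (nseq n h) f y = 0.
  by apply/eqP; have /eqP := f0 y; rewrite mdiff_nseqE scaler_eq0 signr_eq0.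
by rewrite mdiff_nseqE (mdiff_cons h (nseq n h)) !m0 subrr scaler0.
Qed.

Lemma polynomial_functions_is_polynomial (R : realType) m (f : R^o -> R^o) :
  polynomial_functions m f -> is_polynomial f.
Proof.
move=> [p sp fE]; exists m, (p`_0 : R^o), (fun k x => p`_k * \prod_(i < k) x i : R^o).
split=> [k _|t]; last first.
  rewrite fE (horner_coef_wide _ sp) big_ord_recl expr0 mulr1; congr (_ + _).
  rewrite big_add1 /= big_mkord; apply: eq_bigr => i _.
  by rewrite prodr_const card_ord.
split=> [i x a u v|s x].
  have E w : \prod_(j < k) (if j == i then w else x j) =
      w * \prod_(j < k | j != i) x j :> R.
    rewrite (bigD1 i)//= eqxx; congr (_ * _); apply: eq_bigr => j.
    by move=> /negPf ->.
  rewrite !E /GRing.scale /=; ring.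
congr (_ * _); rewrite [RHS](reindex_inj (@perm_inj _ s)).
by [].
Qed.

Lemma is_polynomial_real (R : realType) (f : R^o -> R^o) : is_polynomial f ->
  exists p : {poly R}, forall t, f t = p.[t].
Proof.
move=> /is_polynomial_line[n fL]; have [c cE] := fL 0 1.
exists (\poly_(i < n.+1) c i) => t.
have := cE t; rewrite add0r /GRing.scale /= mulr1 => ->.
by rewrite horner_poly; apply: eq_bigr => i _; rewrite mulrC.
Qed.

Section Equivalences.
Context {R : realType} {E F : tvsType R}.
Hypotheses (hausE : hausdorff_space E) (hausF : hausdorff_space F).
Variables (Phi : E -> F) (contPhi : continuous Phi).

Lemma polynomial_bounded_degree : is_polynomial Phi -> exists m,
  forall (nu : dual F) (h : R^o -> E), Aff h -> polynomial_functions m (nu \o Phi \o h).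
Proof.
move=> /is_polynomial_line[n PhiL]; exists n => nu h /Aff_real hE.
have [c cE] := PhiL (h 0) (h 1 - h 0).
exists (\poly_(i < n.+1) nu (c i)); first exact: size_poly.
by move=> t; rewrite /= hE cE linear_lincomb_line//; exact: dual_linear.
Qed.

Lemma fdiff_dual_polynomial n :
  (forall (nu : dual F) x h, exists p : {poly R}, forall t, nu (Phi (x + t *: h)) = p.[t]) ->
  (forall (nu : dual F) x h, fdiff n.+1 (nu \o Phi : E -> R^o) x h = 0) ->
  is_polynomial Phi.
Proof.
move=> lp f0; exists n.
apply: (@fdiff_polynomial _ _ _
  [set nu : F -> R^o | exists mu : dual F, nu = mu :> (F -> R^o)] _ _ n Phi).
- by move=> _ [mu ->]; exact: dual_linear.
- by move=> w w0; apply: (dual_separates hausF) => mu; apply: w0; exists mu.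
- by move=> _ [mu ->]; exact: lp.
- move=> x h; apply: (dual_separates hausF) => mu.
  by rewrite linear_fdiff ?f0//; exact: dual_linear.
Qed.

Lemma polynomial_functions_fdiff m (nu : dual F) :
  (forall h : R^o -> E, Aff h -> polynomial_functions m (nu \o Phi \o h)) ->
  forall x d, fdiff m.+1 (nu \o Phi : E -> R^o) x d = 0.
Proof.
move=> hm x d; have [p sp pE] := hm _ (Aff_line x d).
apply: (@fdiff_line0 _ _ _ m.+1 m.+1 (fun i => p`_i)) => // t.
rewrite [LHS]pE (horner_coef_wide _ sp); apply: eq_bigr => i _.
by rewrite mulrC.
Qed.

Lemma bounded_degree_polynomial :
  (exists m, forall (nu : dual F) (h : R^o -> E),
     Aff h -> polynomial_functions m (nu \o Phi \o h)) -> is_polynomial Phi.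
Proof.
move=> [m hm]; apply: (@fdiff_dual_polynomial m).
  by move=> nu x h; have [p _ pE] := hm nu _ (Aff_line x h); exists p.
by move=> nu; apply: polynomial_functions_fdiff => h; exact: hm.
Qed.

(** By contraposition: if no degree bound holds, [continuous_fdiff_poly] yields, for each n, a
    nonzero difference of order [n + 1] along some line, and [dense_affine_orbit] applies. *)
Lemma not_dense_bounded_degree : ~ dense (span_in_cont_fun (affine_orbit Phi)) ->
  exists m, forall (nu : dual F) (h : R^o -> E),
    Aff h -> polynomial_functions m (nu \o Phi \o h).
Proof.
apply: contra_notP => unb O [f Of] oO.
have [K [e [cK e0 KO]]] := cont_fun_cvg_compact oO Of.
have cf : continuous ((f : continuousType E R^o) : E -> R^o) by exact: cts_fun.
have unb' n : exists (nu : dual F) (h : R^o -> E) (x d : R),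
    Aff h /\ fdiff n.+1 (nu \o Phi \o h) x d != 0.
  apply: contrapT => hn; apply: unb; exists n => nu h hA.
  apply: continuous_fdiff_poly => [t|x d].
    apply: continuous_comp; first exact: Aff_continuous hA _.
    by apply: continuous_comp; [exact: contPhi|exact: dual_continuous].
  by apply: contrapT => /eqP fd; apply: hn; exists nu, h, x, d.
have [g Sg fg] := dense_affine_orbit hausE contPhi unb' cK cf e0.
have cg : continuous (g : E -> R^o).
  exact: linear_span_continuous (affine_orbit_continuous contPhi) Sg.
by exists (cont_fun_of cg); split; [exact: KO|exact: Sg].
Qed.

Lemma bounded_degree_not_dense : (exists e : E, e != 0) ->
  (exists m, forall (nu : dual F) (h : R^o -> E),
    Aff h -> polynomial_functions m (nu \o Phi \o h)) ->
  ~ dense (span_in_cont_fun (affine_orbit Phi)).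
Proof.
move=> [e e0] [m hm] dS.
have [lam le0] : exists lam : dual E, lam e != 0.
  apply: contrapT => h; move/eqP: e0; apply; apply: (dual_separates hausE) => lam.
  by apply: contrapT => /eqP l0; apply: h; exists lam.
(* A finite combination of point evaluations, hence continuous for the compact-open topology;
   density would give a member of the span at which it is nonzero. *)
pose D (f : cont_fun E) : R^o := fdiff m.+1 ((f : continuousType E R^o) : E -> R^o) 0 e.
have cD : continuous D.
  by apply: continuous_lincomb => i; exact: cont_fun_eval.
have cl : continuous (fun x => lam x ^+ m.+1 : R^o).
  move=> x; apply: (@continuous_comp E R^o R^o lam (fun t => t ^+ m.+1)).
    exact: dual_continuous.
  exact: exprn_continuous.
have [||f [/= Df [n [c [a [Aa fE]]]]]] := dS [set f | D f != 0].
(* On [lam ^+ m.+1] the functional takes the value [(m + 1)! (lam e)^(m+1)] up to sign. *)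
- exists (cont_fun_of cl); rewrite /= /D.
  rewrite (@fdiff_line _ _ _ m.+1 (fun i => if i == m.+1 then lam e ^+ m.+1 else 0)) => [|t].
    rewrite eqxx scaler_eq0 negb_or expf_neq0// andbT.
    by rewrite mulf_neq0 ?signr_eq0// pnatr_eq0 -lt0n fact_gt0.
  rewrite big_ord_recr /= eqxx big1 => [|i _]; last by rewrite ltn_eqF ?scaler0.
  by rewrite !add0r /mkcts (linear_scale (@dual_linear _ _ lam)) exprMn.
- by apply: (@open_comp _ R^o D [set y | y != 0]);
    [move=> x _; exact: cD|exact: open_neq].
suff /eqP : D f = 0 by exact/negP.
rewrite /D fE /fdiff.
under eq_bigr do rewrite fct_lincombE scaler_sumr.
rewrite exchange_big big1 // => i _.
have [nu [g [[T [cT [b gE]]] aE]]] := Aa i.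
under eq_bigr do rewrite scalerA mulrC -scalerA.
rewrite -scaler_sumr aE; apply/eqP; rewrite scaler_eq0; apply/orP; right; apply/eqP.
(* For [g = T + b], the difference of [nu o Phi o g] at 0 with step e is that of [nu o Phi] at b
   with step [T e]. *)
rewrite -[RHS](polynomial_functions_fdiff (hm nu) b (T e)).
apply: eq_bigr => r _; congr (_ *: nu (Phi _)).
by rewrite gE add0r linearZ addrC.
Qed.

Lemma baire_polynomial :
  (forall (nu : dual F) (h : R^o -> E), Aff h -> is_polynomial (nu \o Phi \o h)) ->
  baire_space E ->
  (exists tau : topology_on (dual F),
      [/\ vector_topology tau, stronger_than_weak_star tau &
          baire_space (with_topology tau)]) ->
  is_polynomial Phi.
Proof.
move=> pol bE [tau [vt st bF]].
have lp (nu : dual F) x h : exists p : {poly R}, forall t, nu (Phi (x + t *: h)) = p.[t].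
  exact: is_polynomial_real (pol nu _ (Aff_line x h)).
have [n fn] := baire_bounded_degree contPhi bE vt st bF lp.
apply: (@fdiff_dual_polynomial n) => // nu x h.
by apply: fdiffS_eq0 => y; exact: fn.
Qed.

End Equivalences.

Theorem theorem2p6 (R : realType) (E F : tvsType R)
    (hausE : hausdorff_space E) (hausF : hausdorff_space F)
    (ntE : exists e : E, e != 0) (ntF : exists f : F, f != 0)
    (Phi : E -> F) (contPhi : continuous Phi) :
  let cond_i := is_polynomial Phi in
  let cond_ii := exists m : nat, forall (nu : dual F) (h : R^o -> E),
    Aff h -> polynomial_functions m (nu \o Phi \o h) in
  let cond_iii := ~ dense (span_in_cont_fun
    [set psi : E -> R^o | exists (nu : dual F) (g : E -> E),
       Aff g /\ psi = nu \o Phi \o g]) in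
  let cond_iv := forall (nu : dual F) (h : R^o -> E),
    Aff h -> is_polynomial (nu \o Phi \o h) in
  [<-> cond_i; cond_ii; cond_iii] /\
  (baire_space E ->
   (exists tau : topology_on (dual F),
      [/\ vector_topology tau, stronger_than_weak_star tau &
          baire_space (with_topology tau)]) ->
   [<-> cond_i; cond_ii; cond_iii; cond_iv]).
Proof.
move=> cond_i cond_ii cond_iii cond_iv.
have i_ii : cond_i -> cond_ii := @polynomial_bounded_degree _ _ _ Phi.
have ii_iii : cond_ii -> cond_iii := bounded_degree_not_dense hausE ntE.
have iii_ii : cond_iii -> cond_ii := not_dense_bounded_degree hausE contPhi.
have ii_i : cond_ii -> cond_i := @bounded_degree_polynomial _ _ _ hausF Phi.
(* Both lists are closed into cycles; the implications leaving (iii) pass through (ii). *)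
split=> [|bE tau]; tfae => //.
- by move=> /iii_ii.
- move=> /iii_ii [m hm] nu h hA.
  exact: polynomial_functions_is_polynomial (hm nu h hA).
- by move=> iv; exact: baire_polynomial.
Qed.
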